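(* Let $p\ge2$, $X=\{0,1,\dots,p\}$, and let $\mathcal G_{S_p}$ be the group generated by the transformations $e_1,\dots,e_p$ of $X^\ast\cup X^\infty$ defined recursively by $e_i(0w)=i\,e_i(w)$, $e_i(iw)=0w$, $e_i(jw)=jw$ for $j\notin\{0,i\}$. Let $\Gamma^p$ be any infinite Schreier graph of $\mathcal G_{S_p}$ (for some $w\in X^\infty$: vertex set the orbit of $w$, with an edge joining $v$ and $e_i(v)$ for each vertex $v$ and each $i$). Define $Q_1=\{\sqrt{p^2+2p-1}\}$, $Q_{m+1}=\{\sqrt{p^2+p+sq}: q\in Q_m,\ s\in\{1,-1\}\}$, and $R_n=\{p-1+sq: q\in Q_n,\ s\in\{1,-1\}\}$ (the points $p-1\pm\sqrt{p^2+p\pm\sqrt{p^2+p\pm\cdots\pm\sqrt{p^2+2p-1}}}$ with $n$ radicals). Then the spectrum of $\Gamma^p$ is the closure of $\{2(p-1)\}\cup\bigcup_{n\ge1}R_n$. This set is the union of a Cantor set of zero Lebesgue measure which is symmetric about $p-1$ and a countable collection of isolated points supporting the KNS spectral measure $\mu$; $\mu$ is discrete, with $\mu(\{x\})=\frac{p-1}{(p+1)^{n+1}}$ for each $x\in R_n$, $n\ge1$, and $\mu(\{2(p-1)\})=\frac{p-1}{p+1}$.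
   Context: The spectrum is that of the adjacency operator on $\ell^2$ of the vertex set (loops contribute $2$ to the diagonal). Let $A_n=\sum_{i=1}^p(M_i+M_i^{T})$ be the adjacency matrix of the finite Schreier graph on $X^n$, $M_i$ the permutation matrix of $e_i$ on $X^n$. The KNS spectral measure $\mu$ is the weak limit of the counting measures $\mu_n=(p+1)^{-n}\sum_\lambda\delta_\lambda$, the sum over the eigenvalues of $A_n$ with multiplicity. *)

(* Defs.v *)
From HB Require Import structures.
From mathcomp Require Import all_boot all_order all_algebra.
From mathcomp Require Import all_classical all_reals all_analysis.
Set Implicit Arguments. Unset Strict Implicit. Unset Printing Implicit Defensive.
Import Order.TTheory GRing.Theory Num.Theory.
Import numFieldNormedType.Exports.
Local Open Scope classical_set_scope.
Local Open Scope ring_scope.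

(* The generator e_i on infinite words.  Unfolding the recursion
   e_i(0w) = i e_i(w), e_i(iw) = 0w, e_i(jw) = jw (j <> 0,i):
   the letter at position k is transformed (0 -> i, i -> 0, others fixed)
   iff all earlier letters are 0; otherwise it is left unchanged. *)
Definition swap0 (p : nat) (i a : 'I_p.+1) : 'I_p.+1 :=
  if a == ord0 then i else if a == i then ord0 else a.

Definition e_inf (p : nat) (i : 'I_p.+1) (w : nat -> 'I_p.+1) : nat -> 'I_p.+1 :=
  fun k => if all (fun m => w m == ord0) (iota 0 k) then swap0 i (w k) else w k.

(* Its inverse: e_i^{-1}(0w) = iw, e_i^{-1}(iw) = 0 e_i^{-1}(w), e_i^{-1}(jw) = jw. *)
Definition einv_inf (p : nat) (i : 'I_p.+1) (w : nat -> 'I_p.+1) : nat -> 'I_p.+1 :=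
  fun k => if all (fun m => w m == i) (iota 0 k) then swap0 i (w k) else w k.

Definition e_fin (p n : nat) (i : 'I_p.+1) (w : {ffun 'I_n -> 'I_p.+1}) :
    {ffun 'I_n -> 'I_p.+1} :=
  [ffun k : 'I_n => if [forall m : 'I_n, (m < k)%N ==> (w m == ord0)]
                    then swap0 i (w k) else w k].

Inductive sorbit (p : nat) (w : nat -> 'I_p.+1) : (nat -> 'I_p.+1) -> Prop :=
| orbit_refl : sorbit w w
| orbit_e : forall v (i : 'I_p.+1), i != ord0 -> sorbit w v -> sorbit w (e_inf i v)
| orbit_einv : forall v (i : 'I_p.+1), i != ord0 -> sorbit w v -> sorbit w (einv_inf i v).

Section Spec.
Variable R : realType.

Definition in_l2 (p : nat) (O : set (nat -> 'I_p.+1)) (f : (nat -> 'I_p.+1) -> R) :=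
  (forall v, ~ O v -> f v = 0) /\
  (\esum_(v in O) ((f v) ^+ 2)%:E < +oo)%E.

(* Adjacency operator of the Schreier graph: sum over the edges v -- e_i v
   and e_i^{-1} v -- v, i = 1..p (loops contribute 2). *)
Definition adj_op (p : nat) (f : (nat -> 'I_p.+1) -> R) : (nat -> 'I_p.+1) -> R :=
  fun v => \sum_(i < p.+1 | i != ord0) (f (e_inf i v) + f (einv_inf i v)).

Definition spectrum (p : nat) (O : set (nat -> 'I_p.+1)) : set R :=
  [set lam | ~ (forall g, in_l2 O g ->
        exists! f, in_l2 O f /\ (fun v => adj_op f v - lam * f v) = g)].

Definition adj_mx (p n : nat) : 'M[R]_(#|{ffun 'I_n -> 'I_p.+1}|) :=
  \matrix_(a, b) \sum_(i < p.+1 | i != ord0)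
     (((e_fin i (enum_val b) == enum_val a) : nat)%:R +
      ((e_fin i (enum_val a) == enum_val b) : nat)%:R).

Definition eig_list (N : nat) (A : 'M[R]_N) (s : seq R) :=
  char_poly A = \prod_(x <- s) ('X - x%:P).

(* mu is the KNS spectral measure: weak limit of the counting measures
   mu_n = (p+1)^{-n} sum_lambda delta_lambda. *)
Definition KNS_measure (p : nat) (mu : {measure set R -> \bar R}) :=
  forall (f : R -> R), continuous f -> (exists M, forall x, `|f x| <= M) ->
  forall (s : nat -> seq R), (forall n, eig_list (adj_mx p n) (s n)) ->
  (fun n => ((p.+1%:R ^- n) * \sum_(x <- s n) f x)%:E) @ \oo -->
     (\int[mu]_x (f x)%:E)%E.

(* Q_{m+1} = Qaux m, i.e. Qaux 0 = Q_1. *)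
Fixpoint Qaux (p : nat) (m : nat) : set R :=
  match m with
  | 0 => [set Num.sqrt (p%:R ^+ 2 + 2 * p%:R - 1)]
  | m'.+1 => [set y | exists q, exists s : bool, Qaux p m' q /\
                 y = Num.sqrt (p%:R ^+ 2 + p%:R + (if s then q else - q))]
  end.

Definition Rset (p : nat) (n : nat) : set R :=
  [set y | exists q, exists s : bool, Qaux p n.-1 q /\
      y = p%:R - 1 + (if s then q else - q)].

Definition Sset (p : nat) : set R :=
  [set 2 * (p%:R - 1)] `|` \bigcup_(n in [set n | (1 <= n)%N]) Rset p n.

(* A Cantor set in R: nonempty, compact, perfect, totally disconnected
   (contains no nondegenerate interval). *)
Definition cantor_set (C : set R) :=
  C !=set0 /\ compact C /\
  (forall x, C x -> forall e : R, 0 < e -> exists y, C y /\ y != x /\ `|y - x| < e) /\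
  (forall x y, C x -> C y -> x < y -> exists z, x < z < y /\ ~ C z).

End Spec.

Arguments spectrum : clear implicits.
Arguments KNS_measure : clear implicits.
Arguments Rset : clear implicits.
Arguments Sset : clear implicits.
Arguments cantor_set : clear implicits.

(* Main.v *)
Require Import Defs.
From HB Require Import structures.
From mathcomp Require Import all_boot all_order all_algebra.
From mathcomp Require Import all_classical all_reals all_analysis.
From mathcomp Require Import measurable_realfun perm zify ring lra.
Import Order.TTheory GRing.Theory Num.Theory.
Import numFieldNormedType.Exports.
Local Open Scope classical_set_scope.
Local Open Scope ring_scope.
Set Implicit Arguments. Unset Strict Implicit. Unset Printing Implicit Defensive.

(* Split a function on words according to the first letter.  For the self-similar action the
   adjacency operator becomes a block operator whose diagonal blocks are the scalars 0 (letter 0)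
   and c = 2(p - 1) (other letters); eliminating the latter (Schur complement, legitimate for
   lam <> c) replaces A - lam by A' - phi(lam), where A' is the adjacency operator one level up
   and phi(x) = x^2 - c x - 2p.  On X^n this gives the characteristic polynomial recursively:
   R_n is the set of solutions of phi^n(x) = c, with multiplicity (p - 1)(p + 1)^(N - n - 1) on X^N,
   up to 2^N leftover eigenvalues.  On an orbit it shows that lam is in the spectrum iff phi(lam)
   is in the spectrum for the shifted word, so that a spectral point either reaches c or has a
   bounded phi-orbit.  The points with bounded orbit form the attractor of the two inverse branches
   of phi, which are 1/3-Lipschitz on [-2, 2p]: this is the Cantor set, of measure zero because
   2/3 < 1, and accumulated by the backward orbit of c.  The critical value of phi and c both
   escape, so the backward orbit of c is discrete and disjoint from the Cantor set. *)

(** * Dynamics of phi *)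

(** A parameter is regular when [A - lam] is bijective on square-summable functions, and both
    inclusions for the spectrum are proved from this alone. Renormalization replaces [w] by its
    shift, so the bound beyond which every [lam] is regular must be uniform over all words; escape
    of the phi-orbit then brings regularity back to [lam]. Conversely, each iterated preimage of [c]
    has finitely supported eigenfunctions living on words with a prescribed tail. The choice of the
    tail puts them on any given orbit, and varying it with the level makes supports disjoint, which
    is what defeats solvability at points of the Cantor set. For the measure, [mu] is known only
    through continuous test functions, so its atoms are compared, point by point, with those of an
    explicit sum of Dirac masses. The leftover eigenvalues are the [2^N] iterated preimages of [2p],
    the eigenvalue of the one-vertex graph; their proportion [(2/(p+1))^N] tends to 0 because
    [p >= 2], so the atoms already add up to 1. *)

Lemma geometric_small {R : realType} (a q e : R) : 0 <= q < 1 -> 0 < e ->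
  exists n, a * q ^+ n < e.
Proof.
move=> /andP[q0 q1] e0.
have /cvgr_lt : (geometric a q) @ \oo --> (0 : R).
  by apply: cvg_geometric; rewrite ger0_norm.
by move=> /(_ _ e0) [n _ h]; exists n; exact: (h n (leqnn n)).
Qed.

Section Dynamics.
Context {R : realType} (p : nat).
Implicit Types (x y z : R) (s : bool) (n k : nat).

(** A vertex with first letter [j <> 0] is fixed by the [p - 1] generators other than [e_j], each
    loop counting 2. This is the [c] of the overview, where the Schur complement has its pole. *)
Definition pole : R := 2 * (p%:R - 1).

(** [x (x - pole)] is the product of the two diagonal blocks of [x - A], and [2p] is the scalar part
    of the Gram matrix of the coupling block ([edge_coef_gram]). *)
Definition phi x : R := x ^+ 2 - pole * x - 2 * p%:R.

Definition psi s y : R :=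
  p%:R - 1 + (if s then 1 else -1) * Num.sqrt (p%:R ^+ 2 + 1 + y).

(** The right end is a repelling fixed point of [phi] and the left end is its other preimage; an
    orbit that leaves this interval never returns. *)
Definition trapped x := -2 <= x <= 2 * p%:R.

Fixpoint level n : seq R :=
  if n is n'.+1 then map (psi true) (level n') ++ map (psi false) (level n')
  else [:: pole].

Definition julia : set R := [set x | forall k, trapped (iter k phi x)].

Lemma phi_square x : phi x + (p%:R ^+ 2 + 1) = (x - (p%:R - 1)) ^+ 2.
Proof. rewrite /phi /pole; ring. Qed.

Lemma psiK s y : 0 <= p%:R ^+ 2 + 1 + y -> phi (psi s y) = y.
Proof.
move=> h; have -> : phi (psi s y) =
    ((if s then 1 else -1) * Num.sqrt (p%:R ^+ 2 + 1 + y)) ^+ 2 - (p%:R ^+ 2 + 1).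
  by apply/eqP; rewrite eq_sym subr_eq phi_square /psi; apply/eqP; ring.
by rewrite exprMn sqr_sqrtr//; case: s; ring.
Qed.

Lemma phiK x : psi (p%:R - 1 <= x) (phi x) = x.
Proof.
rewrite /psi addrC (addrC _ (phi x)) phi_square sqrtr_sqr.
case: ifPn => [h|]; first by rewrite ger0_norm ?subr_ge0// mul1r subrK.
rewrite -ltNge => h; rewrite ltr0_norm ?subr_lt0// ; ring.
Qed.

Lemma iter_phi_mem_level n x : iter n phi x = pole -> x \in level n.
Proof.
elim: n x => [|n IH] x /=; first by move=> ->; rewrite inE.
rewrite -iterS iterSr => /IH h; rewrite mem_cat -(phiK x).
by case: (_ <= x); apply/orP; [left|right]; apply: map_f.
Qed.

Hypothesis hp : (2 <= p)%N.
Let ge2p : (2 : R) <= p%:R. Proof. by rewrite (ler_nat _ 2 p). Qed.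

(** Here [p^2 - 1 >= 3]. The critical value [-(p^2 + 1)] of [phi] thus stays at distance at least 3
    from the interval, which keeps the roots in [psi] away from 0. *)
Lemma trapped_radicand y : trapped y -> 3 <= p%:R ^+ 2 + 1 + y.
Proof.
have P2 := ge2p. by move=> /andP[h1 h2]; nra. Qed.

Lemma psi_trapped s y : trapped y -> trapped (psi s y).
Proof.
have P2 := ge2p.
move=> ty; have := trapped_radicand ty => h3; case/andP: ty => h1 h2.
have : Num.sqrt (p%:R ^+ 2 + 1 + y) <= p%:R + 1.
  rewrite -[leRHS]ger0_norm; last lra.
  by rewrite -sqrtr_sqr ler_wsqrtr//; nra.
have := sqrtr_ge0 (p%:R ^+ 2 + 1 + y).
by rewrite /trapped /psi; case: s => ? ?; apply/andP; split; lra.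
Qed.

(** A difference of roots is the difference of the radicands over the sum of the roots; each root is
    at least 3/2 because [9/4 <= 3]. *)
Lemma psi_contract s x y : trapped x -> trapped y ->
  `|psi s x - psi s y| <= `|x - y| / 3.
Proof.
have P2 := ge2p.
move=> /trapped_radicand hx /trapped_radicand hy.
have sq3 z : 3 <= z -> 3 / 2 <= Num.sqrt z.
  move=> hz; rewrite -[leLHS]ger0_norm; last lra.
  by rewrite -sqrtr_sqr ler_wsqrtr//; lra.
set a := p%:R ^+ 2 + 1 + x in hx; set b := p%:R ^+ 2 + 1 + y in hy.
have -> : `|psi s x - psi s y| = `|Num.sqrt a - Num.sqrt b|.
  rewrite /psi -/a -/b opprD addrACA subrr add0r -mulrBr normrM.
  by case: s; rewrite ?normrN normr1 mul1r.
have ha := sq3 _ hx; have hb := sq3 _ hy.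
have e : x - y = (Num.sqrt a - Num.sqrt b) * (Num.sqrt a + Num.sqrt b).
  by rewrite -subr_sqr !sqr_sqrtr; [rewrite /a /b; ring|lra|lra].
rewrite e normrM ler_pdivlMr//; apply: ler_wpM2l => //.
by rewrite ger0_norm; lra.
Qed.

Lemma pole_trapped : trapped pole.
Proof.
have P2 := ge2p. by rewrite /trapped /pole; apply/andP; split; lra. Qed.

Lemma phi_pole : phi pole = - (2 * p%:R).
Proof. rewrite /phi /pole; ring. Qed.

Lemma phi_untrapped x : ~~ trapped x -> 2 * p%:R < phi x.
Proof.
have P2 := ge2p.
rewrite /trapped negb_and -!ltNge => h.
have : 0 < (x - 2 * p%:R) * (x + 2) by case/orP: h => h; nra.
by rewrite /phi /pole; nra.
Qed.

Lemma gt_untrapped x : 2 * p%:R < x -> ~~ trapped x.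
Proof. by move=> h; rewrite /trapped negb_and -!ltNge h orbT. Qed.

Lemma untrapped_iter n x : ~~ trapped x -> ~~ trapped (iter n phi x).
Proof. by elim: n => //= n IH /IH /phi_untrapped /gt_untrapped. Qed.

(** After one step the orbit is to the right of [2p], and [phi y - 2p = (y - 2p)(y + 2)] shows that
    every further step at least doubles the gap to this fixed point. *)
Lemma untrapped_iter_unbounded x : ~~ trapped x ->
  forall M, exists n, M < `|iter n phi x|.
Proof.
have P2 := ge2p.
move=> /phi_untrapped h M; set d := phi x - 2 * p%:R.
have d0 : 0 < d by rewrite subr_gt0.
have grow n : d * 2 ^+ n <= iter n.+1 phi x - 2 * p%:R.
  elim: n => [|n IH]; first by rewrite expr0 mulr1.
  rewrite iterS; move: IH; set y := iter _ _ _ => IH.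
  have e : phi y - 2 * p%:R = (y - 2 * p%:R) * (y + 2) by rewrite /phi /pole; ring.
  have p2n : 0 < (2 : R) ^+ n by rewrite exprn_gt0.
  rewrite e exprS mulrCA mulrC; apply: ler_pM => //; last first.
    by apply: le_trans (_ : _ <= 2 * p%:R + 2) _; [lra|rewrite lerD2r -subr_ge0 (le_trans _ IH)// mulr_ge0 ?ltW].
  by rewrite mulr_ge0 ?ltW.
have [n hn] : exists n, M / d < 2 ^+ n.
  exists (Num.bound (M / d)); apply: (le_lt_trans (ler_norm _)).
  apply: (lt_le_trans (archi_boundP (normr_ge0 _))).
  rewrite -natrX ler_nat; set m := Num.bound _.
  have -> : Num.bound (M / d) = Num.bound `|M / d| by rewrite /Num.bound normr_id.
  exact/ltnW/ltn_expl.
exists n.+1; apply: lt_le_trans (ler_norm _).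
have := grow n; rewrite ltr_pdivrMr// in hn; nra.
Qed.

Lemma bounded_orbit_julia x M : (forall k, `|iter k phi x| <= M) -> julia x.
Proof.
move=> h k; apply: contraPT isT => /untrapped_iter_unbounded /(_ M)[n].
by rewrite -iterD ltNge h.
Qed.

Lemma level_trapped n x : x \in level n -> trapped x.
Proof.
elim: n x => [|n IH] x /=; first by rewrite inE => /eqP ->; exact: pole_trapped.
by rewrite mem_cat => /orP[] /mapP[y /IH hy ->]; exact: psi_trapped.
Qed.

Lemma psiKt s y : trapped y -> phi (psi s y) = y.
Proof.
have P2 := ge2p. by move=> /trapped_radicand h; apply: psiK; lra. Qed.

Lemma mem_levelP n x : (x \in level n) = (iter n phi x == pole).
Proof.
apply/idP/eqP; last exact: iter_phi_mem_level.
elim: n x => [|n IH] x /=; first by rewrite inE => /eqP.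
rewrite -iterS iterSr mem_cat => /orP[] /mapP[y hy ->];
  by rewrite psiKt ?IH//; exact: level_trapped hy.
Qed.

Lemma level_iter_trapped n k x : x \in level n -> (k <= n)%N -> trapped (iter k phi x).
Proof.
rewrite mem_levelP => /eqP e kn; apply: (@level_trapped (n - k)).
by rewrite mem_levelP -iterD subnK// e.
Qed.

(** [pole] is sent to [-2p], left of [-2]. Together with [level_iter_trapped], the time of escape is
    exactly [n + 1]; this separates the levels from each other and from [julia]. *)
Lemma level_iter_untrapped n k x : x \in level n -> (n < k)%N -> ~~ trapped (iter k phi x).
Proof.
have P2 := ge2p.
rewrite mem_levelP => /eqP e nk; rewrite -(subnK nk) iterD.
apply: untrapped_iter; rewrite iterS e phi_pole /trapped negb_and -!ltNge.
by apply/orP; left; lra.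
Qed.

Lemma level_disjoint m n x : x \in level m -> x \in level n -> m = n.
Proof.
move=> hm hn; case: (ltngtP m n) => // h.
- by have := level_iter_untrapped hm h; rewrite (level_iter_trapped hn).
- by have := level_iter_untrapped hn h; rewrite (level_iter_trapped hm).
Qed.

Lemma psi_inj s x y : trapped x -> trapped y -> psi s x = psi s y -> x = y.
Proof. by move=> tx ty e; rewrite -(psiKt s tx) e psiKt. Qed.

Lemma psi_true_false x y : trapped x -> trapped y -> psi true x <> psi false y.
Proof.
have P2 := ge2p.
move=> /trapped_radicand hx /trapped_radicand hy.
rewrite /psi => /addrI; rewrite mul1r mulN1r => e.
have hx0 : 0 < Num.sqrt (p%:R ^+ 2 + 1 + x) by rewrite sqrtr_gt0; lra.
have hy0 : 0 < Num.sqrt (p%:R ^+ 2 + 1 + y) by rewrite sqrtr_gt0; lra.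
by lra.
Qed.

Lemma level_uniq n : uniq (level n).
Proof.
elim: n => //= n IH; rewrite cat_uniq !map_inj_in_uniq ?IH /= ?andbT.
- apply/hasPn => _ /mapP[y /level_trapped hy ->]; apply/mapP => -[z /level_trapped hz].
  by move=> /esym; exact: psi_true_false.
- by move=> x y /level_trapped hx /level_trapped hy; exact: psi_inj.
- by move=> x y /level_trapped hx /level_trapped hy; exact: psi_inj.
Qed.

Lemma size_level n : size (level n) = (2 ^ n)%N.
Proof. by elim: n => //= n IH; rewrite size_cat !size_map IH expnS mul2n addnn. Qed.

(* [psi] pulls a target [z] of the [n]-th iterate back along the itinerary of [x]. *)
Lemma shadowing n x z : (forall k, (k <= n)%N -> trapped (iter k phi x)) ->
  trapped z -> exists y,
  [/\ iter n phi y = z, `|x - y| <= (2 * p%:R + 2) / 3 ^+ n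
    & forall k, (k <= n)%N -> trapped (iter k phi y)].
Proof.
have P2 := ge2p.
elim: n x => [|n IH] x tx tz.
  exists z; split=> //; last by move=> k; rewrite leqn0 => /eqP ->.
  have /andP[? ?] := tx 0%N isT; case/andP: tz => ? ?.
  by rewrite expr0 divr1 ler_norml; apply/andP; split; simpl in *; lra.
have [k kn|//|y [e d ty]] := IH (phi x).
  by rewrite -iterSr; exact: tx.
have ty0 := ty 0%N isT.
exists (psi (p%:R - 1 <= x) y); split.
- by rewrite iterSr psiKt.
- rewrite -[X in `|X - _|]phiK; apply: (le_trans (psi_contract _ _ _)) => //.
    exact: (tx 1%N).
  by rewrite ler_pdivrMr// exprS invfM mulrA mulrAC divfK.
- case=> [|k] kn; first exact: psi_trapped.
  by rewrite iterSr psiKt//; exact: ty.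
Qed.

Lemma julia_approx n x : julia x ->
  exists2 y, y \in level n & `|x - y| <= (2 * p%:R + 2) / 3 ^+ n.
Proof.
move=> jx; have [|y [e d _]] := @shadowing n x pole (fun k _ => jx k).
  exact: pole_trapped.
by exists y => //; rewrite mem_levelP e.
Qed.

Lemma julia_iterE n x : (forall k, (k <= n)%N -> trapped (iter k phi x)) ->
  julia (iter n phi x) -> julia x.
Proof.
move=> tx jx k; case: (leqP k n) => [/tx//|/ltnW nk].
by rewrite -(subnK nk) iterD.
Qed.

Lemma julia_sym x : julia (pole - x) = julia x.
Proof.
have phis y : phi (pole - y) = phi y by rewrite /phi; ring.
have H y : julia y -> julia (pole - y).
  move=> jy [|k]; last by rewrite iterSr phis -iterSr; exact: jy.
  (* Only time 0 needs an argument: were [pole - y] outside the interval, its image [phi y] would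
     exceed [2p]. *)
  rewrite -[trapped _]negbK; apply/negP => /phi_untrapped.
  by rewrite phis ltNge; have /andP[_ ->] := jy 1%N.
apply/propext; split; last exact: H.
by move=> /H; rewrite opprB addrC subrK.
Qed.

Lemma julia_right : julia (2 * p%:R).
Proof.
have P2 := ge2p.
have e : phi (2 * p%:R) = 2 * p%:R by rewrite /phi /pole; ring.
move=> k; have -> : iter k phi (2 * p%:R) = 2 * p%:R by elim: k => //= k ->.
by rewrite /trapped lexx andbT; lra.
Qed.

Lemma julia_left : julia (-2).
Proof.
have P2 := ge2p.
have e : phi (-2) = 2 * p%:R by rewrite /phi /pole; ring.
case=> [|k]; first by rewrite /= /trapped lexx; lra.
by rewrite iterSr e; exact: julia_right.
Qed.

Lemma radius_small (e : R) : 0 < e -> exists n, (2 * p%:R + 2) / 3 ^+ n < e.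
Proof.
move=> /(geometric_small (2 * p%:R + 2) (q := 3^-1))[|n]; first lra.
by rewrite exprVn => h; exists n; exact: h.
Qed.

(** One of the points [-2], [2p] differs from the [n]-th iterate of [x]. Shadowing [x] with that
    target gives a nearby point, distinct from [x] since its [n]-th iterate is. *)
Lemma julia_perfect x : julia x -> forall e : R, 0 < e ->
  exists y, julia y /\ y != x /\ `|y - x| < e.
Proof.
have P2 := ge2p.
move=> jx e /radius_small[n hn].
have [z jz zx] : exists2 z, julia z & z != iter n phi x.
  case: (eqVneq (-2) (iter n phi x)) => [E|]; last by exists (-2) => //; exact: julia_left.
  by exists (2 * p%:R); [exact: julia_right|rewrite -E; apply/eqP; lra].
have [y [E d ty]] := @shadowing n x z (fun k _ => jx k) (jz 0%N).
exists y; split; first by apply: (@julia_iterE n) => //; rewrite E.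
split; first by apply: contraNneq zx => <-; rewrite E.
by rewrite distrC (le_lt_trans d).
Qed.

Lemma julia_level x n : x \in level n -> ~ julia x.
Proof.
by move=> xn jx; have := level_iter_untrapped xn (ltnSn n); rewrite jx.
Qed.

Lemma iter_phi_continuous k : continuous (iter k phi).
Proof.
elim: k => [|k IH] x /=; first exact: cvg_id.
apply: (@continuous_comp _ _ _ (iter k phi) phi); first exact: IH.
apply: cvgB; last exact: cvg_cst.
by apply: cvgB; [exact: exprn_continuous|apply: cvgM; [exact: cvg_cst|exact: cvg_id]].
Qed.

Lemma julia_closed : closed julia.
Proof.
have -> : julia = \bigcap_k (iter k phi) @^-1` `[-2, 2 * p%:R].
  apply/seteqP; split => x.
  - by move=> jx k _; rewrite /= in_itv /=; exact: jx.
  - by move=> jx k; have := jx k I; rewrite /= in_itv.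
apply: closed_bigI => k _; apply: closed_comp; last exact: itv_closed.
by move=> x _; exact: iter_phi_continuous.
Qed.

Lemma julia_compact : compact julia.
Proof.
apply: (subclosed_compact julia_closed (@segment_compact _ (-2) (2 * p%:R))).
by move=> x jx; rewrite /= in_itv /=; exact: (jx 0%N).
Qed.

Definition levels : set R := [set x | exists n, x \in level n].

Lemma sep_seq (l : seq R) x :
  exists2 e : R, 0 < e & forall y, y \in l -> `|y - x| < e -> y = x.
Proof.
elim: l => [|a l [e e0 he]]; first by exists 1.
case: (eqVneq a x) => [->|ax].
  by exists e => // y; rewrite inE => /orP[/eqP ->//|]; exact: he.
exists (Num.min e `|a - x|); first by rewrite lt_min e0 normr_gt0 subr_eq0.
move=> y; rewrite inE lt_min => /orP[/eqP ->|yl] /andP[h1 h2]; last exact: he.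
by rewrite ltxx in h2.
Qed.

(** If [x] has escaped at time [k], so has a whole neighbourhood by continuity, while level [n] is
    still trapped at time [k] when [k <= n]. Only the finitely many points of the levels below [k]
    can come near [x]. *)
Lemma levels_isolated x : ~ julia x ->
  exists2 e : R, 0 < e & forall y, levels y -> `|y - x| < e -> y = x.
Proof.
move=> /existsNP[k /negP tk].
have [e1 e10 he1] : exists2 e : R, 0 < e &
    forall y, `|y - x| < e -> ~~ trapped (iter k phi y).
  have : nbhs x ((iter k phi) @^-1` ~` `[-2, 2 * p%:R]).
    apply: iter_phi_continuous; apply: open_nbhs_nbhs; split.
      exact/closed_openC/itv_closed.
    by rewrite /= in_itv /=; exact/negP.
  rewrite -nbhs_ballE => -[e /= e0 he]; exists e => // y yx; apply/negP => ty.
  by apply: (he y); [rewrite /ball /= distrC|rewrite /= in_itv].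
have [e2 e20 he2] := sep_seq (flatten [seq level n | n <- iota 0 k]) x.
exists (Num.min e1 e2); first by rewrite lt_min e10.
move=> y [n yn]; rewrite lt_min => /andP[/he1 h1 /he2]; apply.
apply/flattenP; exists (level n) => //; apply: map_f.
rewrite mem_iota /= add0n ltnNge; apply: contra h1 => kn.
exact: level_iter_trapped yn kn.
Qed.

Lemma closure_levels : closure levels = julia `|` levels.
Proof.
apply/seteqP; split=> x.
- move=> cx; case: (pselect (julia x)) => [|nj]; [by left|right].
  have [e e0 he] := levels_isolated nj.
  have [y [ly]] := cx _ (nbhsx_ballx x e e0).
  by rewrite /ball /= distrC => /(he _ ly) <-.
- case=> [jx|]; last exact: subset_closure.
  move=> B; rewrite -nbhs_ballE => -[e /= e0 he].
  have [n hn] := radius_small e0; have [y yn d] := julia_approx n jx.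
  exists y; split; first by exists n.
  by apply: he; rewrite /ball /= (le_lt_trans d).
Qed.

Lemma closure_levels_isolated x : levels x -> exists2 e : R, 0 < e &
  forall y, closure levels y -> `|y - x| < e -> y = x.
Proof.
have P2 := ge2p.
move=> [n xn]; have [e e0 he] := levels_isolated (julia_level xn).
exists e => // y cy yx; apply/eqP; apply: contraT => yx0.
have d0 : 0 < `|y - x| by rewrite normr_gt0 subr_eq0.
(* With this radius [z] lies within [e] of [x], hence equals [x], yet is closer to [y] than [x]
   is. *)
set d := Num.min (e - `|y - x|) `|y - x|.
have [|z [lz]] := cy (ball y d).
  by apply: nbhsx_ballx; rewrite lt_min d0 subr_gt0 yx.
rewrite /ball /= lt_min => /andP[h1 h2].
have E : z = x.
  apply: he => //; rewrite -(subrKA y); apply: le_lt_trans (ler_normD _ _) _.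
  by rewrite distrC; lra.
by move: h2; rewrite E ltxx.
Qed.

Lemma levels_countable : countable levels.
Proof.
have -> : levels = \bigcup_n [set` level n].
  by apply/seteqP; split=> x; [move=> [n xn]; exists n|move=> [n _ xn]; exists n].
by apply: bigcup_countable => // n _; exact/finite_set_countable/finite_seq.
Qed.

(** The radicand [p^2 + p + s q] equals [p^2 + 1 + (p - 1 + s q)], so adding one radical means
    applying [psi] to a point of the preceding set. The shift arises because [Qaux p n] is
    [Q_{n+1}]. *)
Lemma QauxE n x : (exists q, exists s : bool, Qaux p n q /\
    x = p%:R - 1 + (if s then q else - q)) <-> x \in level n.+1.
Proof.
elim: n x => [|n IH] x.
  rewrite mem_cat /= !inE /psi /pole.
  have -> : p%:R ^+ 2 + 1 + 2 * (p%:R - 1) = p%:R ^+ 2 + 2 * p%:R - 1 :> R by ring.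
  split=> [[q [s [-> ->]]]|/orP[]/eqP ->].
  - by case: s; rewrite ?mul1r ?mulN1r eqxx ?orbT.
  - by eexists; exists true; split; [reflexivity|rewrite mul1r].
  - by eexists; exists false; split; [reflexivity|rewrite mulN1r].
have E (q : R) (s : bool) : p%:R ^+ 2 + p%:R + (if s then q else - q) =
  p%:R ^+ 2 + 1 + (p%:R - 1 + (if s then q else - q)) by ring.
split.
- move=> [_ [t [[q [s [Qq ->]]] ->]]]; rewrite E.
  have yn : p%:R - 1 + (if s then q else - q) \in level n.+1.
    by apply/IH; exists q, s.
  rewrite [level n.+2]/= -/(level n.+1) mem_cat; apply/orP.
  case: t; [left|right]; apply/mapP; eexists; [exact: yn| |exact: yn| ].
  + by rewrite /psi mul1r.
  + by rewrite /psi mulN1r.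
- rewrite [level n.+2]/= -/(level n.+1) mem_cat.
  move=> /orP[] /mapP[y /IH[q [s [Qq ->]]] ->];
    exists (Num.sqrt (p%:R ^+ 2 + p%:R + (if s then q else - q))).
  + exists true; split; first by exists q, s.
    by rewrite /psi mul1r E.
  + exists false; split; first by exists q, s.
    by rewrite /psi mulN1r E.
Qed.

Lemma RsetE n x : (1 <= n)%N -> Rset R p n x <-> x \in level n.
Proof. by case: n => // n _; exact: QauxE. Qed.

Lemma SsetE : Sset R p = levels.
Proof.
apply/seteqP; split=> x.
- by case=> [->|[n n1 /(RsetE x n1)]]; [exists 0%N; rewrite inE|exists n].
- move=> [[|n]]; first by rewrite inE => /eqP ->; left.
  by right; exists n.+1 => //; exact/RsetE.
Qed.

(** The [2^n] points of level [n], thickened by the shadowing error [(2p + 2) / 3^n], cover the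
    set. *)
Lemma julia_null : lebesgue_measure julia = 0%E.
Proof.
have P2 := ge2p.
have H n : (lebesgue_measure julia <= (2 * (2 * p%:R + 2) * (2 / 3) ^+ n)%:E)%E.
  pose r : R := (2 * p%:R + 2) / 3 ^+ n.
  have r0 : 0 < r by rewrite divr_gt0 ?exprn_gt0//; lra.
  have cover : julia `<=` \bigcup_(y in [set` level n]) `[y - r, y + r]%classic.
    move=> x /(julia_approx n)[y yn]; exists y => //=.
    by rewrite in_itv/= -ler_distl.
  have itv_len y : lebesgue_measure `[y - r, y + r]%classic = (2 * r)%:E.
    rewrite lebesgue_measure_itv/= lte_fin ifT; last lra.
    by rewrite -EFinD; congr _%:E; lra.
  have := content_sub_fsum (@lebesgue_measure R) (finite_seq _)
    (fun y _ => measurable_itv `[y - r, y + r]) (measurable_realfun.closed_measurable julia_closed) cover.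
  move=> /le_trans; apply; rewrite -fsbig_seq ?level_uniq//.
  rewrite (eq_bigr (fun _ => (2 * r)%:E)) => [|y _]; last first.
    exact: itv_len.
  rewrite sumEFin big_const_seq count_predT size_level iter_addr_0.
  by rewrite lee_fin -[leLHS]mulr_natr natrX expr_div_n le_eqVlt /r; apply/orP; left; apply/eqP; ring.
apply/eqP; rewrite eq_le measure_ge0 andbT; apply/lee_addgt0Pr => e e0.
have [|n hn] := geometric_small (2 * (2 * p%:R + 2)) (q := 2 / 3) _ e0; first lra.
by rewrite add0e (le_trans (H n))// lee_fin ltW.
Qed.

(** An interval inside the set would have positive length, against [julia_null]. *)
Lemma julia_no_interval x y : julia x -> julia y -> x < y ->
  exists z, x < z < y /\ ~ julia z.
Proof.
move=> jx jy xy; apply: contrapT => /forallNP h.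
have : (lebesgue_measure `]x, y[%classic <= lebesgue_measure julia)%E.
  apply: le_measure; rewrite ?inE; [exact: measurable_itv|exact: measurable_realfun.closed_measurable julia_closed|].
  move=> z; rewrite /= in_itv /= => hz; apply: contrapT => jz; exact: (h z).
rewrite julia_null lebesgue_measure_itv /= lte_fin xy -EFinD lee_fin.
by rewrite subr_le0 leNgt xy.
Qed.

End Dynamics.

(** * Characteristic polynomials of the finite graphs *)

(** Rows and columns undergo the same permutation, whose sign therefore enters twice. This allows
    words to be listed in blocks by first letter. *)
Lemma det_reindex (K : comNzRingType) (T : finType) (F : T -> T -> K) m (f : 'I_m -> T) :
  bijective f ->
  \det (\matrix_(a < m, b < m) F (f a) (f b)) =
  \det (\matrix_(a < #|T|, b < #|T|) F (enum_val a) (enum_val b)).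
Proof.
move=> fb; have mT : m = #|T| by rewrite -(bij_eq_card fb) card_ord.
subst m; have gi : injective (enum_rank \o f).
  by apply: inj_comp; [exact: enum_rank_inj|exact: bij_inj].
set s := perm gi; set M := (X in _ = \det X).
have -> : \matrix_(a, b) F (f a) (f b) = row_perm s (col_perm s M).
  by apply/matrixP => a b; rewrite !mxE !permE /= !enum_rankK.
rewrite row_permE col_permE !det_mulmx !det_perm mulrC -mulrA -signr_addb.
by rewrite odd_permV addbb mulr1.
Qed.

Section FiniteGraphs.
Context {R : realType} (p : nat).
Local Notation letter := 'I_p.+1.
Local Notation word n := {ffun 'I_n -> letter}.

Definition wcons n (j : letter) (w : word n) : word n.+1 :=
  [ffun k => if unlift ord0 k is Some k' then w k' else j].

Lemma wcons0 n j (w : word n) : wcons j w ord0 = j.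
Proof. by rewrite ffunE unlift_none. Qed.

Lemma wconsS n j (w : word n) k : wcons j w (lift ord0 k) = w k.
Proof. by rewrite ffunE liftK. Qed.

Lemma wcons_eq n j j' (w w' : word n) :
  (wcons j w == wcons j' w') = (j == j') && (w == w').
Proof.
apply/eqP/andP => [e|[/eqP -> /eqP ->]//].
split; apply/eqP; first by rewrite -(wcons0 j w) e wcons0.
by apply/ffunP => k; rewrite -(wconsS j w) e wconsS.
Qed.

Lemma forall_prefixS n j (w : word n) (k : 'I_n) :
  [forall m : 'I_n.+1, (m < lift ord0 k)%N ==> (wcons j w m == ord0)] =
  (j == ord0) && [forall m : 'I_n, (m < k)%N ==> (w m == ord0)].
Proof.
apply/forallP/andP => [h|[/eqP j0 /forallP h] m].
  split; first by have := h ord0; rewrite wcons0.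
  by apply/forallP => m; have := h (lift ord0 m); rewrite wconsS !lift0.
case: (unliftP ord0 m) => [m' ->|->]; last by rewrite wcons0 j0 eqxx implybT.
by rewrite wconsS !lift0; exact: h.
Qed.

Lemma swap0_0 (i : letter) : swap0 i ord0 = i.
Proof. by rewrite /swap0 eqxx. Qed.

Lemma e_fin_wcons n (i j : letter) (w : word n) :
  e_fin i (wcons j w) = if j == ord0 then wcons i (e_fin i w) else wcons (swap0 i j) w.
Proof.
apply/ffunP => k; case: (unliftP ord0 k) => [k' ->|->].
  rewrite ffunE forall_prefixS wconsS; case: (j =P ord0) => _ /=.
    by rewrite wconsS ffunE.
  by rewrite wconsS.
rewrite ffunE wcons0 ifT; last by apply/forallP.
by case: eqP => [->|_]; rewrite wcons0 ?swap0_0.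
Qed.

Lemma swap0K (i : letter) : involutive (swap0 i).
Proof.
move=> a; rewrite /swap0; case: (eqVneq a ord0) => [->|a0].
  by rewrite eqxx; case: eqVneq.
by case: (eqVneq a i) => [->|ai]; rewrite ?eqxx ?(negPf a0) ?(negPf ai).
Qed.

Lemma e_fin_inj n (i : letter) : injective (@e_fin p n i).
Proof.
elim: n => [|n IH] u v; first by move=> _; apply/ffunP => -[].
have split_word (w : word n.+1) : exists j w', w = wcons j w'.
  exists (w ord0), [ffun k => w (lift ord0 k)].
  apply/ffunP => k; case: (unliftP ord0 k) => [k' ->|->]; last by rewrite wcons0.
  by rewrite wconsS ffunE.
have [a [u' ->]] := split_word u; have [b [v' ->]] := split_word v.
rewrite !e_fin_wcons => /eqP.
case: (eqVneq a ord0) => [->|a0]; case: (eqVneq b ord0) => [->|b0];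
  rewrite wcons_eq => /andP[/eqP e /eqP].
- by move=> /IH ->.
- case/eqP: b0; rewrite -(swap0K i b) -e /swap0; case: (i =P ord0) => // _.
  by rewrite eqxx.
- case/eqP: a0; rewrite -(swap0K i a) e /swap0; case: (i =P ord0) => // _.
  by rewrite eqxx.
- by move=> ->; rewrite -(swap0K i a) e swap0K.
Qed.

Definition adj_coef n (u v : word n) : R :=
  \sum_(i < p.+1 | i != ord0) ((e_fin i v == u)%:R + (e_fin i u == v)%:R).

Definition char_coef n (u v : word n) : {poly R} := (u == v)%:R *: 'X - (adj_coef u v)%:P.

Lemma char_poly_adj n : char_poly (adj_mx R p n) =
  \det (\matrix_(a < #|word n|, b < #|word n|) char_coef (enum_val a) (enum_val b)).
Proof.
congr (\det _); apply/matrixP => a b; rewrite !mxE /char_coef.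
by rewrite (inj_eq enum_val_inj) scaler_nat.
Qed.

(** Entry of the block coupling words [0w] to words [jv], with [b = (j, v)]: from [0w], the
    generator [e_j] leads to [j e_j(w)] and its inverse to [jw]; no other generator reaches the
    letter [j]. *)
Definition edge_coef n (w : word n) (b : 'I_p * word n) : R :=
  (e_fin (lift ord0 b.1) w == b.2)%:R + (w == b.2)%:R.

Lemma sum_nz (F : letter -> R) :
  \sum_(i < p.+1 | i != ord0) F i = \sum_(i < p) F (lift ord0 i).
Proof.
rewrite big_mkcond big_ord_recl /= add0r; apply: eq_bigr => i _.
by [].
Qed.

Lemma lift0_neq0 (j : 'I_p) : (lift ord0 j == ord0 :> letter) = false.
Proof. by []. Qed.

Lemma pair_eqb (S T : eqType) (x y : S * T) : (x.1 == y.1) && (x.2 == y.2) = (x == y).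
Proof. by []. Qed.

Lemma swap0_lift (i j j' : 'I_p) :
  (swap0 (lift ord0 i) (lift ord0 j) == lift ord0 j' :> letter) = (i != j) && (j == j').
Proof.
rewrite /swap0 lift0_neq0 (inj_eq lift_inj) [j == i]eq_sym.
by case: (i == j); rewrite //= (inj_eq lift_inj).
Qed.

Lemma swap0_lift0 (i j : 'I_p) :
  (swap0 (lift ord0 i) (lift ord0 j) == ord0 :> letter) = (i == j).
Proof.
by rewrite /swap0 lift0_neq0 (inj_eq lift_inj) [j == i]eq_sym; case: (i == j).
Qed.

Lemma adj_coef_00 n (w w' : word n) : adj_coef (wcons ord0 w) (wcons ord0 w') = 0.
Proof.
rewrite /adj_coef big1// => i i0.
by rewrite !e_fin_wcons !wcons_eq (negPf i0) /= addr0.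
Qed.

Lemma adj_coef_0j n (w : word n) (b : 'I_p * word n) :
  adj_coef (wcons ord0 w) (wcons (lift ord0 b.1) b.2) = edge_coef w b.
Proof.
rewrite /adj_coef sum_nz (bigD1 b.1)//= big1 => [|i ib]; last first.
  rewrite !e_fin_wcons lift0_neq0 !wcons_eq (inj_eq lift_inj) (negPf ib) /=.
  by rewrite swap0_lift0 (negPf ib) addr0.
rewrite !e_fin_wcons lift0_neq0 !wcons_eq swap0_lift0 !eqxx /=.
by rewrite addr0 addrC [b.2 == w]eq_sym.
Qed.

Lemma adj_coef_sym n (u v : word n) : adj_coef u v = adj_coef v u.
Proof. by apply: eq_bigr => i _; rewrite addrC. Qed.

Lemma adj_coef_jj n (b b' : 'I_p * word n) :
  adj_coef (wcons (lift ord0 b.1) b.2) (wcons (lift ord0 b'.1) b'.2) =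
  (b == b')%:R * pole p.
Proof.
rewrite /adj_coef sum_nz.
under eq_bigr => i _ do rewrite !e_fin_wcons !lift0_neq0 !wcons_eq !swap0_lift.
rewrite -pair_eqb [b'.1 == _]eq_sym [b'.2 == _]eq_sym.
case: (eqVneq b.1 b'.1) => [->|_] /=; last first.
  by rewrite mul0r big1// => i _; rewrite !andbF addr0.
under eq_bigr => i _ do rewrite andbT.
case: (b.2 == b'.2) => /=; last by rewrite mul0r big1// => i _; rewrite !andbF addr0.
under eq_bigr => i _ do rewrite andbT -mulr2n.
rewrite (bigD1 b'.1)//= eqxx mul0rn add0r (eq_bigr (fun=> 2)) => [|i ->//].
rewrite big_const iter_addr_0 cardC1 card_ord mul1r /pole.
have : (0 < p)%N by case: (p) b'.1 => // -[].
by case: (p) => //= q _; rewrite -[LHS]mulr_natr -[X in _ = _ * (X - 1)]natr1 addrK.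
Qed.

(** For each [j] the product expands into four terms: two give [w = w'] (one by injectivity of
    [e_j]), the mixed ones are the two [e_j]-edges between [w] and [w']. The adjacency matrix thus
    reappears one level up. *)
Lemma edge_coef_gram n (w w' : word n) :
  \sum_(b : 'I_p * word n) edge_coef w b * edge_coef w' b =
  (2 * p%:R) * (w == w')%:R + adj_coef w w'.
Proof.
have pick (x y : word n) : \sum_v ((x == v)%:R * (y == v)%:R : R) = (x == y)%:R.
  rewrite (bigD1 x)//= eqxx mul1r big1 ?addr0 1?eq_sym// => v vx.
  by rewrite eq_sym (negPf vx) mul0r.
rewrite -(pair_bigA _ (fun j v => edge_coef w (j, v) * edge_coef w' (j, v)))/=.
rewrite /adj_coef sum_nz.
have -> : 2 * p%:R * (w == w')%:R = \sum_(i < p) (2 * (w == w')%:R) :> R.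
  by rewrite sumr_const card_ord -mulr_natr; ring.
rewrite -big_split /=; apply: eq_bigr => j _; rewrite /edge_coef /=.
under eq_bigr => v _ do rewrite mulrDl !mulrDr.
rewrite !big_split /= !pick (inj_eq (@e_fin_inj _ _)) [w == e_fin _ _]eq_sym.
ring.
Qed.

Definition unblock n (k : 'I_(#|word n| + #|{: 'I_p * word n}|)) : word n.+1 :=
  match fintype.split k with
  | inl a => wcons ord0 (enum_val a)
  | inr b => wcons (lift ord0 (enum_val b).1) (enum_val b).2
  end.

Lemma unblockl n a : @unblock n (lshift _ a) = wcons ord0 (enum_val a).
Proof. by rewrite /unblock (unsplitK (inl a)). Qed.

Lemma unblockr n b :
  @unblock n (rshift _ b) = wcons (lift ord0 (enum_val b).1) (enum_val b).2.
Proof. by rewrite /unblock (unsplitK (inr b)). Qed.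

Lemma unblock_bij n : bijective (@unblock n).
Proof.
apply: inj_card_bij.
  move=> k l; rewrite /unblock; case: splitP => a ka; case: splitP => b lb /eqP;
    rewrite wcons_eq ?(eq_sym ord0) ?lift0_neq0//=.
  - by move=> /eqP /enum_val_inj ab; apply: val_inj; rewrite /= ka lb ab.
  - rewrite (inj_eq lift_inj) pair_eqb.
    by move=> /eqP /enum_val_inj ab; apply: val_inj; rewrite /= ka lb ab.
by rewrite card_ord card_prod !card_ffun !card_ord -mulSn -expnS.
Qed.

(** The Schur complement over a polynomial ring: the elimination is done by a multiplication instead
    of inverting ['X - pole], whence the extra power on the left. *)
Lemma char_poly_adjS n : char_poly (adj_mx R p n.+1) * ('X - (pole p)%:P) ^+ (p.+1 ^ n) =
  (char_poly (adj_mx R p n) \Po ('X ^+ 2 - pole p *: 'X - (2 * p%:R)%:P)) *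
  ('X - (pole p)%:P) ^+ (p * p.+1 ^ n).
Proof.
set x := 'X - _; set q := _ - (2 * p%:R)%:P.
rewrite !char_poly_adj -(det_reindex _ (@unblock_bij n)).
set M := \matrix_(a, b) _.
pose B : 'M[{poly R}]_(#|word n|, #|{: 'I_p * word n}|) :=
  \matrix_(a, b) (edge_coef (enum_val a) (enum_val b))%:P.
have ME : M = block_mx 'X%:M (- B) (- B^T) x%:M.
  apply/matrixP => a b; rewrite -[a]splitK -[b]splitK.
  case: (fintype.split a) => a'; case: (fintype.split b) => b';
    rewrite ?block_mxEul ?block_mxEur ?block_mxEdl ?block_mxEdr !mxE /= ?unblockl ?unblockr /char_coef wcons_eq.
  - by rewrite adj_coef_00 polyC0 subr0 (inj_eq enum_val_inj) scaler_nat.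
  - by rewrite adj_coef_0j eq_sym lift0_neq0 /= scale0r sub0r.
  - by rewrite adj_coef_sym adj_coef_0j lift0_neq0 /= scale0r sub0r.
  - rewrite adj_coef_jj (inj_eq lift_inj) pair_eqb.
    rewrite (inj_eq enum_val_inj); case: eqP => _.
      by rewrite scale1r mul1r mulr1n.
    by rewrite scale0r mul0r sub0r polyC0 oppr0 mulr0n.
have gram : B *m B^T = \matrix_(a, b)
    ((2 * p%:R) * (a == b)%:R + adj_coef (enum_val a : word n) (enum_val b))%:P.
  apply/matrixP => a b; rewrite !mxE.
  under eq_bigr => k _ do rewrite !mxE -polyCM.
  rewrite -rmorph_sum /= -(inj_eq enum_val_inj) -edge_coef_gram; congr _%:P.
  by rewrite -(big_enum_val (fun k => edge_coef (enum_val a) k * edge_coef (enum_val b) k)).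
(* The right factor, of determinant [x] to the number of words, clears the lower left block of [M];
   the corner becomes [X (X - pole) - B B^T], which is [phi(X)] minus the smaller adjacency
   matrix. *)
have schur : M *m block_mx x%:M 0 B^T 1%:M = block_mx (('X * x)%:M - B *m B^T) (- B) 0 x%:M.
  rewrite ME mulmx_block !mulmx0 !mulmx1 !add0r !mul_mx_scalar.
  by rewrite mul_scalar_mx scalerN addNr scale_scalar_mx mulNmx mulrC.
have := congr1 determinant schur.
rewrite det_mulmx det_lblock det_ublock !det_scalar expr1n mulr1.
have cP : (p * p.+1 ^ n)%N = #|{: 'I_p * word n}|.
  by rewrite card_prod !card_ffun !card_ord.
have cW : (p.+1 ^ n)%N = #|word n| by rewrite card_ffun !card_ord.
rewrite cP cW => ->; congr (_ * _).
rewrite -[RHS]/(comp_poly q _) -det_map_mx; congr (\det _).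
apply/matrixP => a b; rewrite gram !mxE /char_coef.
rewrite -[RHS]/(_ \Po q) comp_polyB comp_polyZ comp_polyX comp_polyC (inj_eq enum_val_inj).
rewrite /x /q.
rewrite polyCD polyCM; case: eqP => _; rewrite ?mulr1n ?mulr0n ?polyC1 ?polyC0.
  rewrite scale1r -mul_polyC; ring.
rewrite scale0r; ring.
Qed.

(** The multiplicity [p (p+1)^n' - (p+1)^n'] of [pole] is the surplus of exponents in
    [char_poly_adjS]. The initial [2p] counts the [p] loops at the empty word; its iterated
    preimages are the leftover eigenvalues. *)
Fixpoint eigs n : seq R :=
  if n is n'.+1 then
    nseq (p.-1 * p.+1 ^ n') (pole p) ++
    map (psi p true) (eigs n') ++ map (psi p false) (eigs n')
  else [:: 2 * p%:R].

Hypothesis hp : (2 <= p)%N.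

Lemma eigs_trapped n x : x \in eigs n -> trapped p x.
Proof.
elim: n x => [|n IH] x /=.
  by rewrite inE => /eqP ->; exact: (julia_right hp 0).
rewrite !mem_cat => /or3P[/nseqP[-> _]||]; first exact: pole_trapped.
  by move=> /mapP[y /IH hy ->]; exact: psi_trapped.
by move=> /mapP[y /IH hy ->]; exact: psi_trapped.
Qed.

(** Each [phi(X) - x] splits with roots [psi p true x] and [psi p false x]; trapping makes the
    radicand positive, so the square root is genuine. *)
Lemma comp_prod_XsubC (s : seq R) : (forall x, x \in s -> trapped p x) ->
  (\prod_(x <- s) ('X - x%:P)) \Po ('X ^+ 2 - pole p *: 'X - (2 * p%:R)%:P) =
  \prod_(x <- map (psi p true) s ++ map (psi p false) s) ('X - x%:P).
Proof.
move=> hs; rewrite rmorph_prod big_cat /= !big_map -big_split /=.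
rewrite !big_seq; apply: eq_bigr => x /hs /(trapped_radicand hp) h3.
rewrite comp_polyB comp_polyX comp_polyC /psi mul1r mulN1r.
have {1}-> : x = Num.sqrt (p%:R ^+ 2 + 1 + x) ^+ 2 - (p%:R ^+ 2 + 1).
  by rewrite sqr_sqrtr; [ring|lra].
set r := Num.sqrt _; rewrite /pole -mul_polyC.
rewrite !(polyCD, polyCN, polyCM, rmorphXn)/=.
ring.
Qed.

Lemma eig_list_eigs n : eig_list (adj_mx R p n) (eigs n).
Proof.
rewrite /eig_list; elim: n => [|n IH].
  rewrite big_seq1 char_poly_adj.
  have wE (u v : word 0) : u = v by apply/ffunP => -[].
  have w0 : word 0 := [ffun=> ord0].
  rewrite -(@det_reindex _ _ _ 1 (fun=> w0)); last first.
    exists (fun=> ord0) => [k|w]; [by rewrite (ord1 k)|exact: wE].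
  rewrite det_mx11 mxE /char_coef eqxx scale1r /adj_coef (eq_bigr (fun=> 2)) => [|i _].
    by rewrite sum_nz sumr_const card_ord mulr_natr.
  by rewrite (wE (e_fin i w0) w0) eqxx.
have X0 : ('X - (pole p)%:P) ^+ (p.+1 ^ n) != 0 :> {poly R}.
  by rewrite expf_neq0// polyXsubC_eq0.
apply: (mulIf X0); rewrite char_poly_adjS IH comp_prod_XsubC; last exact: eigs_trapped.
rewrite [eigs n.+1]/= [X in _ = X * _]big_cat /= [RHS]mulrAC [LHS]mulrC; congr (_ * _).
rewrite big_nseq iter_mulr mulr1 -exprD; congr (_ ^+ _).
by rewrite -mulSnr prednK// (leq_trans _ hp).
Qed.

End FiniteGraphs.

(** * Renormalization on infinite orbits *)

Section Words.
Context (p : nat).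
Local Notation letter := 'I_p.+1.
Local Notation iword := (nat -> letter).
Implicit Types (i j : letter) (v w z : iword).

Definition icons j w : iword := fun k => if k is k'.+1 then w k' else j.
Definition tail n w : iword := fun k => w (n + k)%N.

Lemma icons_tail w : icons (w 0%N) (tail 1 w) = w.
Proof. by apply/funext => -[]. Qed.

Lemma tail1_icons j w : tail 1 (icons j w) = w.
Proof. by apply/funext. Qed.

Lemma tailS_icons n j w : tail n.+1 (icons j w) = tail n w.
Proof. by apply/funext. Qed.

Lemma icons_inj j : injective (icons j).
Proof. by move=> v w e; rewrite -(tail1_icons j v) e. Qed.

Lemma icons_eq i j v w : (icons i v == icons j w) = (i == j) && (v == w).
Proof.
apply/eqP/andP => [e|[/eqP -> /eqP ->]//]; split; apply/eqP.
  exact: (congr1 (fun f => f 0%N) e).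
by rewrite -(tail1_icons i v) e.
Qed.

Lemma all_iota1 (P : pred nat) k : all P (iota 1 k) = all (fun m => P m.+1) (iota 0 k).
Proof. by rewrite (iotaDl 1 0) all_map. Qed.

Lemma e_inf_icons i j w :
  e_inf i (icons j w) = if j == ord0 then icons i (e_inf i w) else icons (swap0 i j) w.
Proof.
apply/funext => -[|k]; rewrite /e_inf /=.
  by case: eqP => [->|_]; rewrite ?swap0_0.
by rewrite all_iota1; case: (j == ord0).
Qed.

Lemma einv_inf_icons i j w :
  einv_inf i (icons j w) = if j == i then icons ord0 (einv_inf i w) else icons (swap0 i j) w.
Proof.
apply/funext => -[|k]; rewrite /einv_inf /=.
  by case: eqP => [->|_] //; rewrite /swap0 eqxx; case: eqP.
by rewrite all_iota1; case: (j == i).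
Qed.

Lemma swap0_eq0 i j : (swap0 i j == ord0) = (j == i).
Proof.
rewrite /swap0; case: (eqVneq j ord0) => [->|j0]; first by rewrite eq_sym.
by case: (j == i); rewrite ?eqxx ?(negPf j0).
Qed.

Lemma swap0_eqi i j : (swap0 i j == i) = (j == ord0).
Proof.
by rewrite -[j in RHS](swap0K i) swap0_eq0.
Qed.

Lemma einv_infK i : cancel (einv_inf i) (e_inf i).
Proof.
move=> w; apply/funext => k; elim: k w => [|k IH] w; rewrite -[w]icons_tail einv_inf_icons.
  by case: eqP => [->|/eqP h]; rewrite e_inf_icons ?eqxx// swap0_eq0 (negPf h) swap0K.
case: eqP => [->|/eqP h]; rewrite e_inf_icons ?eqxx; first exact: IH.
by rewrite swap0_eq0 (negPf h).
Qed.

Lemma e_infK i : cancel (e_inf i) (einv_inf i).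
Proof.
move=> w; apply/funext => k; elim: k w => [|k IH] w; rewrite -[w]icons_tail e_inf_icons.
  by case: eqP => [->|/eqP h]; rewrite einv_inf_icons ?eqxx// swap0_eqi (negPf h) swap0K.
case: eqP => [->|/eqP h]; rewrite einv_inf_icons ?eqxx; first exact: IH.
by rewrite swap0_eqi (negPf h).
Qed.

Lemma sorbit_trans v w z : sorbit w v -> sorbit v z -> sorbit w z.
Proof.
move=> wv; elim=> [//|y i i0 _|y i i0 _]; [exact: orbit_e|exact: orbit_einv].
Qed.

Lemma sorbit_sym v w : sorbit w v -> sorbit v w.
Proof.
elim=> [|y i i0 _ h|y i i0 _ h]; first exact: orbit_refl.
  by apply: sorbit_trans h; rewrite -{2}(e_infK i y); apply: orbit_einv => //; exact: orbit_refl.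
by apply: sorbit_trans h; rewrite -{2}(einv_infK i y); apply: orbit_e => //; exact: orbit_refl.
Qed.

Lemma sorbit_e w i v : i != ord0 -> sorbit w (e_inf i v) -> sorbit w v.
Proof. by move=> i0 h; rewrite -(e_infK i v); exact: orbit_einv. Qed.

Lemma sorbit_einv w i v : i != ord0 -> sorbit w (einv_inf i v) -> sorbit w v.
Proof. by move=> i0 h; rewrite -(einv_infK i v); exact: orbit_e. Qed.

Lemma sorbit_icons j w : sorbit (icons ord0 w) (icons j w).
Proof.
case: (eqVneq j ord0) => [->|j0]; first exact: orbit_refl.
have -> : icons j w = einv_inf j (icons ord0 w).
  by rewrite einv_inf_icons eq_sym (negPf j0) swap0_0.
by apply: orbit_einv => //; exact: orbit_refl.
Qed.

(** Applying [e_i] twice maps [0z] to [0 e_i(z)], and likewise for the inverse. *)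
Lemma sorbit_icons0 w v : sorbit w v -> sorbit (icons ord0 w) (icons ord0 v).
Proof.
elim=> [|z i i0 _ h|z i i0 _ h]; first exact: orbit_refl.
- have -> : icons ord0 (e_inf i z) = e_inf i (e_inf i (icons ord0 z)).
    rewrite e_inf_icons eqxx e_inf_icons (negPf i0); congr icons; apply/esym/eqP.
    by rewrite swap0_eq0.
  by do 2 apply: orbit_e => //.
- have -> : icons ord0 (einv_inf i z) = einv_inf i (einv_inf i (icons ord0 z)).
    by rewrite einv_inf_icons eq_sym (negPf i0) swap0_0 einv_inf_icons eqxx.
  by do 2 apply: orbit_einv => //.
Qed.

(** An orbit is [p + 1] copies of the orbit of the shifted word, one for each first letter; this
    makes the block decomposition compatible with square-summability on orbits. *)
Lemma sorbit_tail1 w v : sorbit w v <-> sorbit (tail 1 w) (tail 1 v).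
Proof.
split=> [|h].
  elim=> [|z i i0 _ h|z i i0 _ h]; first exact: orbit_refl.
  - rewrite -(icons_tail z) e_inf_icons; case: ifP => _; rewrite tail1_icons//.
    exact: orbit_e.
  - rewrite -(icons_tail z) einv_inf_icons; case: ifP => _; rewrite tail1_icons//.
    exact: orbit_einv.
rewrite -(icons_tail w) -(icons_tail v).
apply: sorbit_trans (sorbit_sym (sorbit_icons _ _)) _.
exact: sorbit_trans (sorbit_icons0 h) (sorbit_icons _ _).
Qed.

Lemma tail_tail m n w : tail m (tail n w) = tail (n + m) w.
Proof. by apply/funext => k; rewrite /tail addnA. Qed.

Lemma sorbit_tail n w v : sorbit (tail n w) (tail n v) -> sorbit w v.
Proof.
elim: n => [|n IH]; first by [].
by rewrite -(addn1 n) -(tail_tail 1 n w) -(tail_tail 1 n v) => /(proj2 (sorbit_tail1 _ _)); exact: IH.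
Qed.

End Words.

(** * Square-summable functions through finite sums *)

Section SquareSummable.
Context {R : realType} {T : choiceType}.
Implicit Types (f g u : T -> R) (s r : seq T).

(** Finite sums with an explicit bound stay in [R], and the bound survives pointwise limits. *)
Definition sqle f (B : R) := forall s, uniq s -> \sum_(v <- s) f v ^+ 2 <= B.

Lemma esum_sq_ltyP (O : set T) f : (forall v, ~ O v -> f v = 0) ->
  (\esum_(v in O) ((f v) ^+ 2)%:E < +oo)%E <-> exists B, sqle f B.
Proof.
move=> f0; split=> [lty|[B hB]].
  have fn : (\esum_(v in O) ((f v) ^+ 2)%:E)%E \is a fin_num.
    by rewrite ge0_fin_numE ?esum_ge0// => v _; rewrite lee_fin sqr_ge0.
  exists (fine (\esum_(v in O) ((f v) ^+ 2)%:E)%E) => s us.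
  rewrite -lee_fin fineK//; apply: esum_ge.
  exists [set` [seq v <- s | `[< O v >]]].
    split; first exact: finite_seq.
    by move=> v /=; rewrite mem_filter => /andP[/asboolP].
  rewrite -fsbig_seq ?filter_uniq// sumEFin lee_fin big_filter [leRHS]big_mkcond /= le_eqVlt.
  apply/orP; left; apply/eqP; apply: eq_bigr => v _; case: asboolP => // /f0 ->.
  by rewrite expr0n.
apply: (@le_lt_trans _ _ B%:E); last exact: ltry.
apply: ge_ereal_sup => _ [X [fX _] <-].
rewrite fsbig_finite// sumEFin lee_fin; exact: hB.
Qed.

Lemma sqle_pt f B v : sqle f B -> f v ^+ 2 <= B.
Proof. by move=> /(_ [:: v] isT); rewrite big_seq1. Qed.

Lemma sqle_ge0 f B : sqle f B -> 0 <= B.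
Proof. by move=> /(_ [::] isT); rewrite big_nil. Qed.

Lemma sqle_norm f B v : sqle f B -> `|f v| <= B + 1.
Proof.
move=> fB; have h := sqle_pt v fB; have B0 := sqle_ge0 fB.
by rewrite ler_norml; apply/andP; split; nra.
Qed.

Lemma sqle_inj f (h : T -> T) B : injective h -> sqle f B -> sqle (f \o h) B.
Proof.
by move=> hi fB s us; have := fB (map h s); rewrite map_inj_uniq// big_map; exact.
Qed.

Lemma sqle_ext f g B : f =1 g -> sqle f B -> sqle g B.
Proof. by move=> /funext ->. Qed.

Lemma sqleD f g A B : sqle f A -> sqle g B -> sqle (fun v => f v + g v) (2 * A + 2 * B).
Proof.
move=> fA gB s us.
apply: (@le_trans _ _ (2 * \sum_(v <- s) f v ^+ 2 + 2 * \sum_(v <- s) g v ^+ 2)).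
  rewrite !mulr_sumr -big_split /=; apply: ler_sum => v _.
  by have := sqr_ge0 (f v - g v); nra.
by have := fA s us; have := gB s us; lra.
Qed.

Lemma sqleZ f B (c : R) : sqle f B -> sqle (fun v => c * f v) (c ^+ 2 * B).
Proof.
move=> fB s us; under eq_bigr do rewrite exprMn; rewrite -mulr_sumr.
by apply: ler_wpM2l; [exact: sqr_ge0|exact: fB].
Qed.

Lemma sqle_sum (I : Type) (q : seq I) (P : pred I) (F : I -> T -> R) B : 0 <= B ->
  (forall i, P i -> sqle (F i) B) ->
  sqle (fun v => \sum_(i <- q | P i) F i v) (4 ^+ size q * B).
Proof.
move=> B0 FB; elim: q => [|i q IH] s us.
  under eq_bigr do rewrite big_nil expr0n; rewrite big1// expr0 mul1r//.
have q1 : 1 <= (4 : R) ^+ size q by rewrite exprn_ege1//; lra.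
under eq_bigr do rewrite big_cons.
rewrite [size _]/= exprS; move: (FB i); case: (P i) => [/(_ isT) Fi|_].
  by apply: le_trans (sqleD Fi IH us) _; nra.
by apply: le_trans (IH s us) _; nra.
Qed.

Lemma sum_sq_sub u r s : uniq r -> uniq s -> (forall z, u z != 0 -> z \in r) ->
  \sum_(z <- s) u z ^+ 2 <= \sum_(z <- r) u z ^+ 2.
Proof.
move=> ur us sub.
have -> : \sum_(z <- s) u z ^+ 2 = \sum_(z <- s | z \in r) u z ^+ 2.
  rewrite [RHS]big_mkcond /=; apply: eq_bigr => z _; case: ifPn => // zr.
  by apply/eqP; rewrite sqrf_eq0; apply: contraNT zr; exact: sub.
rewrite [leRHS](bigID (mem s)) /= -big_filter -[X in _ <= X + _]big_filter.
rewrite (perm_big [seq z <- r | z \in s]) /=; last first.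
  by apply: uniq_perm; rewrite ?filter_uniq// => z; rewrite !mem_filter andbC.
by rewrite lerDl sumr_ge0// => z _; exact: sqr_ge0.
Qed.

(** Change of variables over a list that need not be stable under [h]: only terms with [u z != 0]
    survive, and [s] holds those [z] and their images. *)
Lemma sum_transport f u (h h' : T -> T) s : cancel h h' -> cancel h' h -> uniq s ->
  (forall z, u z != 0 -> z \in s /\ h z \in s) ->
  \sum_(z <- s) f (h z) * u z = \sum_(z <- s) f z * u (h' z).
Proof.
move=> hK hK' us sub.
have H (F : T -> R) (G : pred T) : (forall z, ~~ G z -> F z = 0) ->
    \sum_(z <- s) F z = \sum_(z <- [seq z <- s | G z]) F z.
  move=> FG; rewrite big_filter [RHS]big_mkcond; apply: eq_bigr => z _.
  by case: ifPn => // /FG.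
rewrite (H _ (fun z => u z != 0)); last by move=> z /negPn/eqP ->; rewrite mulr0.
rewrite (H (fun z => f z * u (h' z)) (fun z => u (h' z) != 0)); last first.
  by move=> z /negPn/eqP ->; rewrite mulr0.
rewrite (eq_bigr (fun z => f (h z) * u (h' (h z)))); last by move=> z _; rewrite hK.
rewrite -(big_map h xpredT (fun z => f z * u (h' z))); apply: perm_big.
apply: uniq_perm; rewrite ?filter_uniq// ?map_inj_uniq ?filter_uniq//; first exact: can_inj hK.
move=> z; rewrite mem_filter; apply/mapP/andP => [[y]|[uz zs]].
  by rewrite mem_filter => /andP[uy ys] ->; rewrite hK; have [] := sub _ uy.
by exists (h' z); rewrite ?hK'// mem_filter uz; have [] := sub _ uz.
Qed.

End SquareSummable.

(** * Block form of the adjacency operator and its Schur complement *)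

Section Renormalization.
Context {R : realType} (p : nat).
Local Notation letter := 'I_p.+1.
Local Notation iword := (nat -> letter).
Implicit Types (i j : letter) (v w z : iword) (f g u : iword -> R) (lam : R).

Definition section j f : iword -> R := fun v => f (icons j v).

Definition resolvent_at w lam := forall g, in_l2 (sorbit w) g ->
  exists! f, in_l2 (sorbit w) f /\ (fun v => adj_op f v - lam * f v) = g.

Lemma in_l2P w f : in_l2 (sorbit w) f <->
  (forall v, ~ sorbit w v -> f v = 0) /\ exists B, sqle f B.
Proof.
by split=> -[f0 h]; split=> //; [apply/(esum_sq_ltyP f0)|apply/(esum_sq_ltyP f0)].
Qed.

Lemma adj_op_icons f j v : adj_op f (icons j v) =
  if j == ord0 then \sum_(i < p.+1 | i != ord0) (section i f (e_inf i v) + section i f v)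
  else section ord0 f v + section ord0 f (einv_inf j v) + pole p * section j f v.
Proof.
rewrite /adj_op; case: eqP => [->|/eqP j0].
  apply: eq_bigr => i i0; rewrite e_inf_icons eqxx einv_inf_icons eq_sym (negPf i0).
  by rewrite swap0_0.
rewrite (bigD1 j)//= e_inf_icons (negPf j0) einv_inf_icons eqxx.
have -> : swap0 j j = ord0 by apply/eqP; rewrite swap0_eq0.
congr (_ + _); rewrite (eq_bigr (fun=> 2 * section j f v)); last first.
  move=> i /andP[i0 ij]; rewrite e_inf_icons (negPf j0) einv_inf_icons eq_sym (negPf ij).
  by rewrite /swap0 (negPf j0) eq_sym (negPf ij) /section; ring.
rewrite big_const iter_addr_0.
have -> : #|[pred i : letter | (i != ord0) && (i != j)]| = p.-1.
  have : (2 + #|[pred i : letter | (i != ord0) && (i != j)]| = p.+1)%N.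
    rewrite -[RHS](card_ord p.+1) -(cardC (pred2 ord0 j)) card2 eq_sym j0.
    by congr addn; apply: eq_card => i; rewrite !inE negb_or.
  by case=> /(congr1 predn).
have p0 : (0 < p)%N.
  by case: (p) j j0 => // j; rewrite (ord1 j) eqxx.
have -> : pole p = 2 * p.-1%:R :> R by rewrite /pole -subn1 natrB.
rewrite -mulr_natr; ring.
Qed.

(** Back-substitution: at a word [jv] with [j <> 0], the equation reads [f0 v + f0 (e_j^{-1} v) +
    (pole - lam) f(jv) = g(jv)] and determines [f(jv)]. *)
Definition assemble (f0 : iword -> R) g lam : iword -> R := fun v =>
  if v 0%N == ord0 then f0 (tail 1 v)
  else (f0 (tail 1 v) + f0 (einv_inf (v 0%N) (tail 1 v)) - g v) / (lam - pole p).

Lemma assemble0 f0 g lam : section ord0 (assemble f0 g lam) = f0.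
Proof. by apply/funext => v; rewrite /section /assemble eqxx tail1_icons. Qed.

Lemma assembleS f0 g lam j v : j != ord0 -> section j (assemble f0 g lam) v =
  (f0 v + f0 (einv_inf j v) - section j g v) / (lam - pole p).
Proof. by move=> j0; rewrite /section /assemble /= (negPf j0) tail1_icons. Qed.

Definition reduced_rhs lam g : iword -> R := fun v =>
  (lam - pole p) * section ord0 g v +
  \sum_(i < p.+1 | i != ord0) (section i g (e_inf i v) + section i g v).

Lemma section_ext f g : (forall j, section j f = section j g) -> f = g.
Proof.
move=> h; apply/funext => v; rewrite -(icons_tail v).
exact: (congr1 (fun F => F (tail 1 v)) (h (v 0%N))).
Qed.

(** Stated for arbitrary functions, so that it serves both for solving in the square-summable space
    and for lifting eigenfunctions. *)
Lemma schurE lam f g : lam != pole p ->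
  (fun v => adj_op f v - lam * f v) = g <->
  (fun v => adj_op (section ord0 f) v - phi p lam * section ord0 f v) = reduced_rhs lam g
  /\ f = assemble (section ord0 f) g lam.
Proof.
rewrite -subr_eq0 => x0; set x := lam - pole p in x0 *.
have eqS j : j != ord0 -> (forall v, adj_op f (icons j v) - lam * f (icons j v) = g (icons j v)) <->
    section j f = section j (assemble (section ord0 f) g lam).
  move=> j0; split=> [h|h v].
    apply/funext => v; rewrite assembleS// -/x; apply: (mulIf x0); rewrite divfK//.
    by have := h v; rewrite adj_op_icons (negPf j0) /section /x => <-; ring.
  rewrite adj_op_icons (negPf j0).
  have := congr1 (fun F => F v * x) h; rewrite /= assembleS// divfK// /x /section; lra.
(* Infinite counterpart of the Gram computation: [f0 (e_i v) + f0 (e_i^{-1} (e_i v))] and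
   [f0 v + f0 (e_i^{-1} v)] add up to [2 f0 v] plus the two [e_i]-neighbours. *)
have sumE v : (forall j, j != ord0 -> section j f = section j (assemble (section ord0 f) g lam)) ->
    (\sum_(i < p.+1 | i != ord0) (section i f (e_inf i v) + section i f v)) * x =
    2 * p%:R * section ord0 f v + adj_op (section ord0 f) v -
    \sum_(i < p.+1 | i != ord0) (section i g (e_inf i v) + section i g v).
  move=> h; have -> : 2 * p%:R * section ord0 f v =
      \sum_(i < p.+1 | i != ord0) 2 * section ord0 f v.
    by rewrite sum_nz sumr_const card_ord -mulr_natr; ring.
  rewrite /adj_op -big_split -sumrB /= mulr_suml; apply: eq_bigr => i i0.
  rewrite (h i i0) mulrDl !assembleS// !divfK// e_infK; ring.
have phiE : phi p lam = lam * x - 2 * p%:R by rewrite /phi /x; ring.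
split=> [h|[h0 hS]].
  have hS j : j != ord0 -> section j f = section j (assemble (section ord0 f) g lam).
    by move=> j0; apply/(eqS j j0) => v; rewrite -h.
  split.
    apply/funext => v; rewrite phiE /reduced_rhs -/x.
    have := congr1 (fun F => F (icons ord0 v) * x) h.
    rewrite /= adj_op_icons eqxx mulrBl (sumE v hS) -/(section ord0 f v) -/(section ord0 g v).
    lra.
  apply: section_ext => j; case: (eqVneq j ord0) => [->|/hS//].
  by rewrite assemble0.
have hSj j : j != ord0 -> section j f = section j (assemble (section ord0 f) g lam).
  by move=> _; rewrite -hS.
apply/funext => v; rewrite -(icons_tail v); move: (v 0%N) (tail 1 v) => j {}v.
case: (eqVneq j ord0) => [->|j0]; last exact: (proj2 (eqS j j0) (hSj j j0) v).
rewrite adj_op_icons eqxx; apply: (mulIf x0); rewrite mulrBl (sumE v hSj).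
have := congr1 (fun F => F v) h0; rewrite /= phiE /reduced_rhs -/x /section; lra.
Qed.

Lemma sqle_section j f B : sqle f B -> sqle (section j f) B.
Proof. exact/sqle_inj/icons_inj. Qed.

Lemma sqle_parts f (B : letter -> R) :
  (forall j, sqle (section j f) (B j)) -> sqle f (\sum_j B j).
Proof.
move=> h s us; rewrite (partition_big (fun v : iword => v 0%N) xpredT)//=.
apply: ler_sum => j _.
rewrite -big_filter (eq_big_seq (fun v => section j f (tail 1 v) ^+ 2)).
  rewrite -(big_map (tail 1) xpredT (fun v => section j f v ^+ 2)); apply: h.
  rewrite map_inj_in_uniq ?filter_uniq// => v z; rewrite !mem_filter.
  move=> /andP[/eqP vj _] /andP[/eqP zj _] e.
  by rewrite -(icons_tail v) -(icons_tail z) vj zj e.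
by move=> v; rewrite mem_filter /section => /andP[/eqP <- _]; rewrite icons_tail.
Qed.

Lemma in_l2_section w j f : in_l2 (sorbit w) f -> in_l2 (sorbit (tail 1 w)) (section j f).
Proof.
move=> /in_l2P[f0 [B fB]]; apply/in_l2P; split; last by exists B; exact: sqle_section.
move=> v nv; apply: f0 => /sorbit_tail1; rewrite tail1_icons; exact: nv.
Qed.

Lemma in_l2_parts w f : (forall j, in_l2 (sorbit (tail 1 w)) (section j f)) ->
  in_l2 (sorbit w) f.
Proof.
move=> h; apply/in_l2P; split.
  move=> v nv; rewrite -(icons_tail v); have /in_l2P[h0 _] := h (v 0%N); apply: h0.
  by move=> hv; apply: nv; exact/sorbit_tail1.
have /choice[B hB] : forall j, exists B, sqle (section j f) B.
  by move=> j; have /in_l2P[_] := h j.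
by exists (\sum_j B j); exact: sqle_parts.
Qed.

Lemma in_l2D w f g : in_l2 (sorbit w) f -> in_l2 (sorbit w) g ->
  in_l2 (sorbit w) (fun v => f v + g v).
Proof.
move=> /in_l2P[f0 [A fA]] /in_l2P[g0 [B gB]]; apply/in_l2P; split.
  by move=> v nv; rewrite f0// g0// addr0.
by exists (2 * A + 2 * B); exact: sqleD.
Qed.

Lemma in_l2Z w f (c : R) : in_l2 (sorbit w) f -> in_l2 (sorbit w) (fun v => c * f v).
Proof.
move=> /in_l2P[f0 [A fA]]; apply/in_l2P; split.
  by move=> v nv; rewrite f0// mulr0.
by exists (c ^+ 2 * A); exact: sqleZ.
Qed.

Lemma in_l2_0 w : in_l2 (sorbit w) (fun=> 0 : R).
Proof.
by apply/in_l2P; split=> //; exists 0 => s _; rewrite big1// => v _; rewrite expr0n.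
Qed.

Lemma in_l2_e w i f : i != ord0 -> in_l2 (sorbit w) f ->
  in_l2 (sorbit w) (fun v => f (e_inf i v)).
Proof.
move=> i0 /in_l2P[f0 [A fA]]; apply/in_l2P; split.
  by move=> v nv; apply: f0 => h; apply: nv; exact: sorbit_e h.
by exists A; apply: sqle_inj fA; exact: can_inj (e_infK i).
Qed.

Lemma in_l2_einv w i f : i != ord0 -> in_l2 (sorbit w) f ->
  in_l2 (sorbit w) (fun v => f (einv_inf i v)).
Proof.
move=> i0 /in_l2P[f0 [A fA]]; apply/in_l2P; split.
  by move=> v nv; apply: f0 => h; apply: nv; exact: sorbit_einv h.
by exists A; apply: sqle_inj fA; exact: can_inj (einv_infK i).
Qed.

Lemma in_l2_sum w (I : Type) (q : seq I) (P : pred I) (F : I -> iword -> R) :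
  (forall k, P k -> in_l2 (sorbit w) (F k)) ->
  in_l2 (sorbit w) (fun v => \sum_(k <- q | P k) F k v).
Proof.
move=> h; elim: q => [|k q IH].
  by under eq_fun do rewrite big_nil; exact: in_l2_0.
under eq_fun do rewrite big_cons.
by move: (h k); case: (P k) => [/(_ isT) hi|_//]; exact: in_l2D.
Qed.

Lemma in_l2_assemble w f0 g lam : in_l2 (sorbit (tail 1 w)) f0 ->
  in_l2 (sorbit w) g -> in_l2 (sorbit w) (assemble f0 g lam).
Proof.
move=> hf hg; apply: in_l2_parts => j; case: (eqVneq j ord0) => [->|j0].
  by rewrite assemble0.
have -> : section j (assemble f0 g lam) = (fun v => (lam - pole p)^-1 *
    ((f0 v + f0 (einv_inf j v)) + (-1) * section j g v)).
  by apply/funext => v; rewrite assembleS// mulN1r mulrC.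
apply: in_l2Z; apply: in_l2D; first by apply: in_l2D => //; exact: in_l2_einv.
by apply: in_l2Z; exact: in_l2_section.
Qed.

Lemma in_l2_reduced_rhs w g lam : in_l2 (sorbit w) g ->
  in_l2 (sorbit (tail 1 w)) (reduced_rhs lam g).
Proof.
move=> hg; apply: in_l2D; first by apply: in_l2Z; exact: in_l2_section.
apply: in_l2_sum => i i0; apply: in_l2D; last exact: in_l2_section.
by apply: in_l2_e => //; exact: in_l2_section.
Qed.

(** Existence and uniqueness both pass through [schurE]; iterated, this brings regularity back from
    a far iterate of [lam]. *)
Lemma resolvent_renorm w lam : lam != pole p ->
  resolvent_at (tail 1 w) (phi p lam) -> resolvent_at w lam.
Proof.
move=> lp res g hg.
have [f0 [[hf0 ef0] uf0]] := res _ (in_l2_reduced_rhs lam hg).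
exists (assemble f0 g lam); split.
  split; first exact: in_l2_assemble.
  by apply/schurE => //; rewrite assemble0.
move=> f [hf /(schurE _ _ lp)[e1 ->]]; congr assemble; apply: uf0.
by split=> //; exact: in_l2_section.
Qed.

Lemma lift_eigen u lam : lam != pole p ->
  (forall v, adj_op u v = phi p lam * u v) ->
  forall v, adj_op (assemble u (fun=> 0) lam) v = lam * assemble u (fun=> 0) lam v.
Proof.
move=> lp hu v; apply/eqP; rewrite -subr_eq0; apply/eqP.
suff /(congr1 (fun F => F v)) : (fun v => adj_op (assemble u (fun=> 0) lam) v -
  lam * assemble u (fun=> 0) lam v) = (fun=> 0) by [].
apply/schurE => //; rewrite assemble0; split=> //; apply/funext => z.
rewrite hu subrr /reduced_rhs /section mulr0 add0r big1// => i _; exact: addr0.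
Qed.

End Renormalization.

(** * The spectrum of an orbit *)

Section LargeSpectralParameter.
Context {R : realType} (p : nat).
Local Notation letter := 'I_p.+1.
Local Notation iword := (nat -> letter).
Implicit Types (i j : letter) (v w z : iword) (f g u : iword -> R) (lam : R).

Lemma adj_sqle : exists2 K : R, 0 <= K &
  forall f B, sqle f B -> sqle (adj_op f) (K * B).
Proof.
exists (4 ^+ size (index_enum letter) * 4); first by rewrite mulr_ge0 ?exprn_ge0.
move=> f B fB; have B0 := sqle_ge0 fB.
rewrite -mulrA; apply: sqle_sum; first lra.
move=> i _; have -> : 4 * B = 2 * B + 2 * B by lra.
by apply: sqleD; apply: sqle_inj fB; [exact: can_inj (e_infK i)|exact: can_inj (einv_infK i)].
Qed.

Lemma adj_norm f (S : R) : (forall v, `|f v| <= S) -> forall v, `|adj_op f v| <= 2 * p%:R * S.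
Proof.
move=> fS v; apply: le_trans (ler_norm_sum _ _ _) _.
have -> : 2 * p%:R * S = \sum_(i < p.+1 | i != ord0) (S + S).
  by rewrite sum_nz sumr_const card_ord -[RHS]mulr_natr; ring.
by apply: ler_sum => i _; apply: le_trans (ler_normD _ _) _; apply: lerD.
Qed.

Lemma adj_opB f g v : adj_op (fun z => f z - g z) v = adj_op f v - adj_op g v.
Proof. by rewrite /adj_op -sumrB; apply: eq_bigr => i _; ring. Qed.

Lemma cvg_sum_seq (I : Type) (q : seq I) (P : pred I) (F : I -> nat -> R) (l : I -> R) :
  (forall k, F k @ \oo --> l k) ->
  (fun n => \sum_(k <- q | P k) F k n) @ \oo --> \sum_(k <- q | P k) l k.
Proof.
move=> h; elim: q => [|k q IH].
  by rewrite big_nil; under eq_fun do rewrite big_nil; exact: cvg_cst.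
rewrite big_cons; under eq_fun do rewrite big_cons.
by case: (P k) => //; apply: cvgD.
Qed.

Lemma adj_op_cvg (F : nat -> iword -> R) f v : (forall z, F ^~ z @ \oo --> f z) ->
  (fun n => adj_op (F n) v) @ \oo --> adj_op f v.
Proof.
move=> h; apply: (@cvg_sum_seq _ _ _ (fun i n => F n (e_inf i v) + F n (einv_inf i v))
  (fun i => f (e_inf i v) + f (einv_inf i v))) => i.
by apply: cvgD; exact: h.
Qed.

Lemma adj_op_supp w f : (forall v, ~ sorbit w v -> f v = 0) ->
  forall v, ~ sorbit w v -> adj_op f v = 0.
Proof.
move=> f0 v nv; rewrite /adj_op big1// => i i0.
by rewrite !f0 ?addr0// => h; apply: nv; [exact: sorbit_einv h|exact: sorbit_e h].
Qed.

Lemma geometric_le0 (a S : R) : (forall k, a <= S * 2^-1 ^+ k) -> a <= 0.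
Proof.
move=> h; rewrite leNgt; apply/negP => a0.
have [|k hk] := geometric_small S (q := 2^-1) _ a0; first lra.
by have := h k; rewrite leNgt hk.
Qed.

Section LargeParameter.
Variables (K lam : R) (w : iword).
Hypotheses (K0 : 0 <= K) (hK : forall f B, sqle f B -> sqle (adj_op f) (K * B)).
(** The term [4p] makes [A / lam] at least halve sup norms; [K + 2] gives [2K + 2 <= lam^2], so that
    one approximation step preserves the bound on sums of squares. *)
Hypothesis lamL : K + 4 * p%:R + 2 < `|lam|.

Let L0 : 0 < `|lam|.
Proof. by apply: le_lt_trans lamL; have := ler0n R p; have := K0; lra. Qed.

Let lam0 : lam != 0. Proof. by rewrite -normr_gt0. Qed.

Lemma eigen_large_eq0 f B : sqle f B -> (forall v, adj_op f v = lam * f v) ->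
  forall v, f v = 0.
Proof.
move=> fB ev v; have K0' := K0; have L0' := L0; have lamL' := lamL.
have p0 := ler0n R p.
have h k : forall v, `|f v| <= (B + 1) * 2^-1 ^+ k.
  elim: k => [|k IH] z; first by rewrite expr0 mulr1; exact: sqle_norm fB.
  rewrite exprSr mulrA -(ler_pM2l L0) -normrM -ev.
  apply: le_trans (adj_norm IH z) _.
  have : 0 <= (B + 1) * 2^-1 ^+ k by apply: le_trans (IH z).
  by set c := (B + 1) * _; nra.
by apply/eqP; rewrite -normr_le0; apply: (@geometric_le0 _ (B + 1)) => k; exact: h.
Qed.

(** Iterates for the fixed-point equation [f = (A f - g) / lam], that is, partial sums of the
    Neumann series. They converge pointwise by the sup-norm estimate, with a uniform square-sum
    bound. *)
Fixpoint approximant g k : iword -> R :=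
  if k is k'.+1 then fun v => (adj_op (approximant g k') v - g v) / lam else fun=> 0.

Lemma approximant_sqle g G k : sqle g G -> sqle (approximant g k) G.
Proof.
move=> gG; have G0 := sqle_ge0 gG; elim: k => [|k IH].
  by move=> s _; rewrite big1// => v _; rewrite expr0n.
have h : sqle (fun v => adj_op (approximant g k) v + -1 * g v) (2 * (K * G) + 2 * ((-1) ^+ 2 * G)).
  by apply: sqleD; [exact: hK|exact: sqleZ].
have {}h := sqleZ lam^-1 h.
move=> s us; apply: le_trans (_ : _ <= lam^-1 ^+ 2 * (2 * (K * G) + 2 * ((-1) ^+ 2 * G))) _.
  by rewrite (eq_bigr (fun v => (lam^-1 * (adj_op (approximant g k) v + -1 * g v)) ^+ 2)) ?h// => v _; rewrite mulN1r mulrC.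
rewrite exprVn ler_pdivrMl ?exprn_even_gt0// -[lam ^+ 2]real_normK ?num_real//.
have h2 : 2 * K + 2 <= `|lam| ^+ 2.
  by have := K0; have := lamL; have := ler0n R p; nra.
rewrite sqrrN expr1n mul1r (_ : 2 * (K * G) + 2 * G = (2 * K + 2) * G); last ring.
exact: ler_wpM2r.
Qed.

Lemma approximant_step g G k v : sqle g G ->
  `|approximant g k.+1 v - approximant g k v| <= (G + 1) * 2^-1 ^+ k.
Proof.
move=> gG; have K0' := K0; have L0' := L0; have lamL' := lamL; have p0 := ler0n R p.
have G0 := sqle_ge0 gG.
elim: k v => [|k IH] v.
  rewrite expr0 mulr1 /= subr0 /adj_op big1 ?sub0r; last by move=> i _; rewrite addr0.
  rewrite normrM normrN normfV ler_pdivrMr//.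
  by have := sqle_norm v gG; nra.
have -> : approximant g k.+2 v - approximant g k.+1 v =
    adj_op (fun z => approximant g k.+1 z - approximant g k z) v / lam.
  by rewrite adj_opB [approximant g k.+2 v]/= [X in _ - X = _]/= -mulrBl; congr (_ / _); ring.
rewrite normrM normfV ler_pdivrMr//; apply: le_trans (adj_norm IH v) _.
have : 0 <= (G + 1) * 2^-1 ^+ k by apply: le_trans (IH v).
rewrite (_ : (G + 1) * 2^-1 ^+ k.+1 = (G + 1) * 2^-1 ^+ k / 2); last first.
  by rewrite exprSr mulrA.
by set c := (G + 1) * _; nra.
Qed.

Lemma approximant_cvg g G v : sqle g G -> cvgn (approximant g ^~ v).
Proof.
move=> gG; set t := telescope (approximant g ^~ v).
have -> : approximant g ^~ v = series t.
  by rewrite telescopeK; apply/funext => n /=; rewrite subr0.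
apply: normed_cvg; apply: (@series_le_cvg _ _ (geometric (G + 1) 2^-1)).
- by move=> n; exact: normr_ge0.
- by move=> n; have G0 := sqle_ge0 gG; rewrite /= mulr_ge0 ?exprn_ge0//; lra.
- by move=> n; exact: approximant_step.
- by apply: is_cvg_geometric_series; rewrite ger0_norm//; lra.
Qed.

Lemma resolvent_large : resolvent_at w lam.
Proof.
move=> g /in_l2P[g0 [G gG]]; pose f v := limn (approximant g ^~ v).
have fc v : approximant g ^~ v @ \oo --> f v by exact: approximant_cvg gG.
(* As in Fatou's lemma, the bound on each finite sum passes to the pointwise limit. *)
have fG : sqle f G.
  move=> s us; have h : (fun k => \sum_(v <- s) approximant g k v ^+ 2) @ \oo -->
      \sum_(v <- s) f v ^+ 2.
    apply: cvg_sum_seq => v; under eq_fun do rewrite expr2.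
    by rewrite expr2; apply: cvgM; exact: fc.
  by apply: (cvgr_to_le h); apply: nearW => k; exact: approximant_sqle.
have f0 v : ~ sorbit w v -> f v = 0.
  move=> nv; have z k : approximant g k v = 0.
    elim: k v nv => //= k IH v nv; rewrite (adj_op_supp (w := w))// g0// subrr mul0r//.
  by apply/cvg_lim => //; rewrite (_ : approximant g ^~ v = fun=> 0); [exact: cvg_cst|exact/funext].
have fE v : adj_op f v - lam * f v = g v.
  have h1 : (fun k => approximant g k.+1 v) @ \oo --> (adj_op f v - g v) / lam.
    apply: cvgM; last exact: cvg_cst.
    by apply: cvgB; [exact: adj_op_cvg|exact: cvg_cst].
  have h2 : (fun k => approximant g k.+1 v) @ \oo --> f v.
    by rewrite (cvg_shiftS (approximant g ^~ v)); exact: fc.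
  have -> : f v = (adj_op f v - g v) / lam by apply: (cvg_unique _ h2 h1).
  by rewrite mulrCA divff// mulr1 subKr.
exists f; split.
  by split; [apply/in_l2P; split=> //; exists G|exact/funext].
move=> f' [/in_l2P[f'0 [B f'B]] f'E]; apply/funext => v; apply/eqP.
rewrite -subr_eq0; apply/eqP.
have := @eigen_large_eq0 (fun v => f v - f' v); apply.
  by have := sqleD fG (sqleZ (-1) f'B); apply: sqle_ext => z; rewrite mulN1r.
move=> z; rewrite adj_opB mulrBr; apply/eqP; rewrite -subr_eq0; apply/eqP.
have := fE z; rewrite -(congr1 (fun F => F z) f'E) /=; lra.
Qed.

End LargeParameter.

(** [M] is chosen before [w] because renormalization applies the bound to the successive tails of a
    word. *)
Lemma resolvent_large_ex : exists M : R, forall w lam, M < `|lam| -> resolvent_at w lam.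
Proof.
have [K K0 hK] := adj_sqle; exists (K + 4 * p%:R + 2) => w lam.
exact: resolvent_large.
Qed.

Lemma resolvent_untrapped n w lam M : (forall w lam, M < `|lam| -> resolvent_at w lam) ->
  (forall k, iter k (phi p) lam != pole p) -> M < `|iter n (phi p) lam| ->
  resolvent_at w lam.
Proof.
move=> hM; elim: n w lam => [|n IH] w lam np hn; first exact: hM.
apply: resolvent_renorm; first exact: (np 0%N).
by apply: IH; rewrite -?iterSr// => k; rewrite -iterSr.
Qed.

End LargeSpectralParameter.

(** * Finitely supported eigenfunctions and the points they force into the spectrum *)

Section Eigenfunctions.
Context {R : realType} (p : nat).
Local Notation letter := 'I_p.+1.
Local Notation iword := (nat -> letter).
Implicit Types (i j : letter) (v w z : iword) (f g u : iword -> R) (lam : R).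
Hypothesis hp : (2 <= p)%N.

(* The prefix is non-constant, so no [e_inf i] can carry past position [m]. *)
Definition confined m v u := forall z, u z != 0 ->
  tail m z = v /\ exists2 k, (k < m)%N & z k != z 0%N.

(** The inverse of [e_i] carries past position [m] only on the prefix [i...i], which it turns into
    the constant prefix [0...0]. *)
Lemma einv_inf_nonconst i m z : i != ord0 ->
  (exists2 k, (k < m)%N & einv_inf i z k != einv_inf i z 0%N) ->
  tail m (einv_inf i z) = tail m z /\ exists2 k, (k < m)%N & z k != i.
Proof.
move=> i0 [k km zk].
have H : exists2 k, (k < m)%N & z k != i.
  apply: contrapT => nex.
  have zi l : (l < m)%N -> z l = i.
    by move=> lm; apply/eqP; apply: contraT => nz; case: nex; exists l.
  have e0 l : (l < m)%N -> einv_inf i z l = ord0.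
    move=> lm; rewrite /einv_inf ifT ?zi//.
      by apply/eqP; rewrite swap0_eq0.
    by apply/allP => q; rewrite mem_iota /= add0n => ql; rewrite zi// (ltn_trans ql).
  by move: zk; rewrite !e0// (leq_ltn_trans _ km).
split=> //; case: H => q qm zq; apply/funext => l; rewrite /tail /einv_inf ifN//.
apply/allPn; exists q => //; rewrite mem_iota/= add0n.
exact: leq_trans qm (leq_addr _ _).
Qed.

Lemma confined_assemble m v u lam : confined m v u ->
  confined m.+1 v (assemble u (fun=> 0) lam).
Proof.
move=> hu z; rewrite -(icons_tail z); move: (z 0%N) (tail 1 z) => j {}z.
rewrite tailS_icons /assemble /= tail1_icons.
(* Prepending [y] keeps the prefix nonconstant: either [y] is the old first letter and the witness
   shifts by one, or positions 0 and 1 differ. *)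
have base y : u z != 0 -> tail m z = v /\ exists2 k, (k < m.+1)%N & icons y z k != icons y z 0%N.
  move=> /hu[-> [k km zk]]; split=> //; case: (eqVneq (z 0%N) y) => [e|ne].
    by exists k.+1 => //=; rewrite -e.
  by exists 1%N => //; rewrite ltnS (leq_ltn_trans _ km).
case: (j =P ord0) => [_|/eqP j0]; first exact: (base j).
case: (eqVneq (u z) 0) => [->|/(base j)]; last by [].
rewrite add0r subr0; case: (eqVneq (u (einv_inf j z)) 0) => [->|]; first by rewrite mul0r eqxx.
move=> /hu[<- /(einv_inf_nonconst j0)[-> [k km zk]]] _; split=> //.
by exists k.+1.
Qed.

Let one : letter := inord 1.
Let two : letter := inord 2.

Let one0 : (one == ord0) = false.
Proof. by apply/eqP => /(congr1 val); rewrite /= inordK// ltnS ltnW. Qed.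
Let two0 : (two == ord0) = false.
Proof. by apply/eqP => /(congr1 val); rewrite /= inordK. Qed.
Let two1 : (two == one) = false.
Proof. by apply/eqP => /(congr1 val); rewrite /= !inordK// ltnS ltnW. Qed.

(** Point masses at [102v] minus [112v]. Since [e_1] exchanges [02v] and [12v], the contributions to
    words starting with 0 cancel, leaving only the diagonal value [pole]; the letter 2, available as
    [p >= 2], stops the carry. *)
Definition seed_fun v : iword -> R := fun z =>
  (z == icons one (icons ord0 (icons two v)))%:R -
  (z == icons one (icons one (icons two v)))%:R.

Lemma section_seed j v : section j (seed_fun v) = fun z => (j == one)%:R *
  ((z == icons ord0 (icons two v))%:R - (z == icons one (icons two v))%:R).
Proof.
apply/funext => z; rewrite /section /seed_fun !(icons_eq j).
by case: (j == one); rewrite ?mul1r ?mul0r ?subrr.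
Qed.

Lemma seed_eigen v z : adj_op (seed_fun v) z = pole p * seed_fun v z.
Proof.
rewrite -(icons_tail z); move: (z 0%N) (tail 1 z) => j {}z.
rewrite adj_op_icons -/(section j (seed_fun v) z); case: eqP => [->|/eqP j0].
  rewrite section_seed eq_sym one0 mul0r mulr0 (bigD1 one) ?one0//= [X in _ + X]big1.
    rewrite section_seed eqxx !mul1r addr0.
    have e1 : e_inf one (icons ord0 (icons two v)) = icons one (icons two v).
      by rewrite e_inf_icons eqxx e_inf_icons two0 /swap0 two0 two1.
    have e2 : e_inf one (icons one (icons two v)) = icons ord0 (icons two v).
      by rewrite e_inf_icons one0; congr icons; apply/eqP; rewrite swap0_eq0.
    rewrite -[X in e_inf one z == X]e2 -[X in _ - (e_inf one z == X)%:R]e1.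
    rewrite !(inj_eq (can_inj (e_infK one))); ring.
  by move=> i /andP[_ /negPf i1]; rewrite section_seed i1 !mul0r addr0.
by rewrite section_seed eq_sym one0 !mul0r !add0r.
Qed.

Lemma seed_confined v : confined 3 v (seed_fun v).
Proof.
move=> z; rewrite /seed_fun.
case: (z =P icons one (icons ord0 _)) => [-> _|_]; first by split; [exact/funext|exists 1%N; rewrite //= eq_sym one0].
case: (z =P _) => [-> _|_]; last by rewrite subrr eqxx.
by split; [exact/funext|exists 2%N; rewrite //= two1].
Qed.

Lemma seed_neq0 v : exists z, seed_fun v z != 0.
Proof.
exists (icons one (icons ord0 (icons two v))).
by rewrite /seed_fun eqxx !icons_eq eqxx [ord0 == _]eq_sym one0 /= subr0 oner_neq0.
Qed.

(** The seed uses three letters and each lift through the Schur complement prepends one. The tail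
    [v] remains free, to be chosen for the orbit at hand. *)
Lemma eigenfunction n lam v : lam \in level p n -> exists u,
  [/\ forall z, adj_op u z = lam * u z, confined (n + 3) v u & exists z, u z != 0].
Proof.
elim: n lam => [|n IH] lam hl.
  move: hl; rewrite inE => /eqP ->; exists (seed_fun v).
  by split; [exact: seed_eigen|exact: seed_confined|exact: seed_neq0].
have lp : lam != pole p.
  apply: contraTN hl => /eqP ->; apply/negP => h.
  by have := level_disjoint hp h (_ : pole p \in level p 0); rewrite inE eqxx => /(_ isT).
have hl' : phi p lam \in level p n by move: hl; rewrite !mem_levelP// iterSr.
have [u [eu cu [z uz]]] := IH _ hl'.
exists (assemble u (fun=> 0) lam); split.
- exact: lift_eigen.
- exact: confined_assemble.
- by exists (icons ord0 z); rewrite -/(section ord0 _ z) assemble0.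
Qed.

Lemma confined_finite m v u : confined m v u -> exists r, uniq r /\ forall z, u z != 0 -> z \in r.
Proof.
move=> hu.
have [r hr] : exists r : seq iword, forall z, tail m z = v -> z \in r.
  move: hu => _; elim: m => [|m [r hr]].
    by exists [:: v] => z; rewrite inE => <-; apply/eqP/funext.
  exists [seq icons j y | j <- enum letter, y <- r] => z hz.
  rewrite -(icons_tail z); apply/allpairsP; exists (z 0%N, tail 1 z); split=> //=.
    by rewrite mem_enum.
  by apply: hr; rewrite tail_tail add1n.
exists (undup r); split; first exact: undup_uniq.
by move=> z /hu[hz _]; rewrite mem_undup hr.
Qed.

Lemma normalized_eigenfunction n lam v : lam \in level p n -> exists (u : iword -> R) r,
  [/\ forall z, adj_op u z = lam * u z, confined (n + 3) v u,
      uniq r, (forall z, u z != 0 -> z \in r) & \sum_(z <- r) u z ^+ 2 = 1].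
Proof.
move=> /(eigenfunction v)[u [eu cu [z0 uz0]]].
have [r [ur hr]] := confined_finite cu.
set N := \sum_(z <- r) u z ^+ 2.
have N0 : 0 < N.
  rewrite /N (bigD1_seq z0) ?hr//=; apply: ltr_pwDl.
    by rewrite exprn_even_gt0.
  by rewrite sumr_ge0// => z _; exact: sqr_ge0.
exists (fun z => u z / Num.sqrt N), r.
have s0 : (Num.sqrt N)^-1 != 0 by rewrite invr_eq0 sqrtr_eq0 -ltNge.
have nz z : u z / Num.sqrt N != 0 -> u z != 0 by apply: contraNneq => ->; rewrite mul0r.
split=> //.
- move=> z; rewrite mulrA -eu /adj_op mulr_suml; apply: eq_bigr => i _; ring.
- by move=> z /nz; exact: cu.
- by move=> z /nz; exact: hr.
- under eq_bigr do rewrite expr_div_n sqr_sqrtr ?ltW//.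
  by rewrite -mulr_suml -/N divff// gt_eqF.
Qed.

Lemma sum_supp (F : iword -> R) u (r s : seq iword) : uniq r -> uniq s ->
  (forall z, u z != 0 -> z \in r) -> (forall z, z \in r -> z \in s) ->
  \sum_(z <- r) F z * u z = \sum_(z <- s) F z * u z.
Proof.
move=> ur us hr rs.
rewrite [RHS](bigID (mem r)) /= [X in _ + X]big1 ?addr0; last first.
  by move=> z zr; apply/eqP; rewrite mulf_eq0; apply/orP; right; apply: contraNT zr; exact: hr.
rewrite -[RHS]big_filter; apply: perm_big; apply: uniq_perm; rewrite ?filter_uniq// => z.
by rewrite mem_filter; case: (boolP (z \in r)) => // /rs ->.
Qed.

(** Symmetry of the adjacency operator against a finitely supported eigenfunction; [f] may be any
    function. *)
Lemma adj_op_sym f u (r : seq iword) lam : uniq r -> (forall z, u z != 0 -> z \in r) ->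
  (forall z, adj_op u z = lam * u z) ->
  \sum_(z <- r) adj_op f z * u z = lam * \sum_(z <- r) f z * u z.
Proof.
move=> ur hr eu.
(* The support is enlarged by its neighbours so that each [e_i] can be moved across the finite
   sum. *)
pose s := undup (r ++ [seq e_inf i z | i <- enum letter, z <- r] ++
                 [seq einv_inf i z | i <- enum letter, z <- r]).
have us : uniq s by exact: undup_uniq.
have rs z : z \in r -> z \in s by move=> zr; rewrite mem_undup !mem_cat zr.
have es i z : z \in r -> e_inf i z \in s.
  move=> zr; rewrite mem_undup !mem_cat; apply/or3P; apply: Or32.
  by apply/allpairsP; exists (i, z); rewrite /= mem_enum.
have vs i z : z \in r -> einv_inf i z \in s.
  move=> zr; rewrite mem_undup !mem_cat; apply/or3P; apply: Or33.
  by apply/allpairsP; exists (i, z); rewrite /= mem_enum.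
rewrite !(sum_supp _ ur us hr rs) mulr_sumr.
rewrite [RHS](eq_bigr (fun z => f z * adj_op u z)); last by move=> z _; rewrite eu; ring.
under [LHS]eq_bigr do rewrite /adj_op mulr_suml.
under [RHS]eq_bigr do rewrite /adj_op mulr_sumr.
rewrite exchange_big [RHS]exchange_big /=; apply: eq_bigr => i _.
under [LHS]eq_bigr do rewrite mulrDl.
under [RHS]eq_bigr do rewrite mulrDr.
rewrite !big_split /= addrC; congr (_ + _).
  apply: (sum_transport f (einv_infK i) (e_infK i) us).
  by move=> z /hr zr; split; [exact: rs|exact: vs].
apply: (sum_transport f (e_infK i) (einv_infK i) us).
by move=> z /hr zr; split; [exact: rs|exact: es].
Qed.

(** Uniqueness fails for the zero right-hand side; the tail of [w] places the eigenfunction on its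
    orbit. *)
Lemma level_not_resolvent w n lam : lam \in level p n -> ~ resolvent_at w lam.
Proof.
move=> hl res; have [u [r [eu cu ur hr u1]]] := normalized_eigenfunction (tail (n + 3) w) hl.
have hu : in_l2 (sorbit w) u.
  apply/in_l2P; split; last by exists 1 => s us; rewrite -u1; exact: sum_sq_sub.
  move=> z nz; apply/eqP; apply: contraT => /cu[hz _]; case: nz.
  by apply: (@sorbit_tail _ (n + 3)); rewrite hz; exact: orbit_refl.
have [f [_ uf]] := res _ (in_l2_0 w).
have f0 : f = (fun=> 0).
  apply: uf; split; first exact: in_l2_0.
  by apply/funext => z; rewrite mulr0 subr0 /adj_op big1// => i _; rewrite addr0.
have fu : f = u by apply: uf; split=> //; apply/funext => z; rewrite eu subrr.
move: u1; rewrite -fu f0 big1 ?(eq_sym 0)//; first by move/esym/eqP; rewrite oner_eq0.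
by move=> z _; rewrite expr0n.
Qed.

Lemma sum_geometric3 (a : R) N : 0 <= a -> \sum_(n < N) a / 3 ^+ n <= 2 * a.
Proof.
move=> a0; suff : \sum_(n < N) a / 3 ^+ n + 3 / 2 * (a / 3 ^+ N) = 3 / 2 * a.
  have : 0 <= a / 3 ^+ N by rewrite divr_ge0// exprn_ge0.
  lra.
elim: N => [|N IH]; first by rewrite big_ord0 expr0 divr1 add0r.
rewrite big_ord_recr /= -{}IH exprSr invfM mulrA; lra.
Qed.

(* Gliding hump: eigenfunctions [u n] with disjoint supports and eigenvalues [l n] tending to
   [lam]; solving [(A - lam) f = sum_n sqrt |l n - lam| u n] forces [<f, u n>] to blow up. *)
Lemma julia_not_resolvent w lam : julia p lam -> ~ resolvent_at w lam.
Proof.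
move=> jl res.
have /choice[l hl] : forall n, exists y, y \in level p n /\ `|lam - y| <= (2 * p%:R + 2) / 3 ^+ n.
  by move=> n; have [y yn d] := julia_approx hp n jl; exists y.
(* The support of [u n] departs from [w] at position [n + 3] and agrees with it afterwards. For
   [m < n], the support of [u m] already agrees with [w] there, so the supports are disjoint and all
   in the orbit. *)
pose c n : letter := if w (n + 3)%N == ord0 then one else ord0.
have cn n : c n != w (n + 3)%N.
  by rewrite /c; case: (w (n + 3)%N =P ord0) => [->|/eqP]; rewrite ?one0// eq_sym.
have /choice[u hu] : forall n, exists u : iword -> R, exists r : seq iword,
  [/\ forall z, adj_op u z = l n * u z, confined (n + 3) (icons (c n) (tail (n + 4) w)) u,
      uniq r, (forall z, u z != 0 -> z \in r) & \sum_(z <- r) u z ^+ 2 = 1].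
  by move=> n; apply: normalized_eigenfunction; have [] := hl n.
have supp n z : u n z != 0 -> z (n + 3)%N = c n /\ tail (n + 4) z = tail (n + 4) w.
  have [r [_ cu _ _ _]] := hu n; move=> /cu[hz _]; split.
    by have := congr1 (fun x : iword => x 0%N) hz; rewrite /tail addn0.
  have -> : tail (n + 4) z = tail 1 (tail (n + 3) z) by rewrite tail_tail -addnA.
  by rewrite hz tail1_icons.
have disj m n z : u m z != 0 -> u n z != 0 -> m = n.
  wlog mn : m n / (m < n)%N.
    move=> h um un; case: (ltngtP m n) => // [mn|nm]; first exact: h.
    by apply/esym; exact: h.
  move=> /supp[_ tm] /supp[zn _].
  have := congr1 (fun x : iword => x (n - m.+1)%N) tm; rewrite /tail.
  have -> : (m + 4 + (n - m.+1) = n + 3)%N.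
    lia.
  by rewrite zn => e; have := cn n; rewrite e eqxx.
pose d n := `|l n - lam|.
have d0 n : 0 < d n.
  rewrite normr_gt0 subr_eq0; apply/negP => /eqP e; have [h _] := hl n.
  by apply: (julia_level hp h); rewrite e.
have dn n : d n <= (2 * p%:R + 2) / 3 ^+ n by rewrite /d distrC; have [] := hl n.
have a0 : 0 <= 2 * p%:R + 2 :> R by have := ler0n R p; lra.
(* The only index with [u n z != 0]; elsewhere the default 0 is harmless, as then [u 0 z = 0]. *)
pose idx z := xget 0%N [set n | u n z != 0].
pose g z := Num.sqrt (d (idx z)) * u (idx z) z.
have gE n z : u n z != 0 -> g z = Num.sqrt (d n) * u n z.
  move=> un; have -> : n = idx z by apply: (disj _ _ _ un); exact: (@xgetPex _ 0%N [set n | u n z != 0] (ex_intro _ n un)).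
  by [].
have hg : in_l2 (sorbit w) g.
  apply/in_l2P; split.
    move=> z nz; rewrite /g; case: (eqVneq (u (idx z) z) 0) => [->|/supp[_ hz]].
      by rewrite mulr0.
    case: nz; apply: (@sorbit_tail _ (idx z + 4)); rewrite hz; exact: orbit_refl.
  exists (2 * (2 * p%:R + 2)) => s us.
  pose N := (\max_(z <- s) idx z).+1.
  apply: le_trans (sum_geometric3 N a0).
  apply: (@le_trans _ _ (\sum_(n < N) d n * \sum_(z <- s) u n z ^+ 2)); last first.
    apply: ler_sum => n _; have [r [_ _ ur hr u1]] := hu n.
    apply: le_trans (dn n); rewrite -[leRHS]mulr1; apply: ler_wpM2l; first exact: ltW.
    by rewrite -u1; exact: sum_sq_sub.
  under [leRHS]eq_bigr do rewrite mulr_sumr.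
  rewrite exchange_big /= big_seq [leRHS]big_seq; apply: ler_sum => z zs.
  have zN : (idx z < N)%N by rewrite /N ltnS (big_rem z)//= leq_maxl.
  rewrite (bigD1 (Ordinal zN))//= /g exprMn sqr_sqrtr; last exact: ltW (d0 _).
  rewrite lerDl.
  by apply: sumr_ge0 => n _; rewrite mulr_ge0 ?sqr_ge0// ltW.
have [f [[/in_l2P[_ [F hF]] ef] _]] := res _ hg.
have F0 := sqle_ge0 hF.
(* Pairing the equation with [u n] gives [(l n - lam) <f, u n> = sqrt (d n)], while
   [2ab <= a^2 + b^2] gives [|<f, u n>| <= (F + 1) / 2]. This is incompatible with [d n] tending to
   0. *)
have key n : 2 <= Num.sqrt (d n) * (F + 1).
  have [r [eu _ ur hr u1]] := hu n.
  have e : (l n - lam) * \sum_(z <- r) f z * u n z = Num.sqrt (d n).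
    rewrite mulrBl -(adj_op_sym f ur hr eu) mulr_sumr -sumrB.
    rewrite (eq_bigr (fun z => Num.sqrt (d n) * u n z ^+ 2)) => [|z _].
      by rewrite -mulr_sumr u1 mulr1.
    rewrite mulrA -mulrBl -[_ - _]/((fun v => adj_op f v - lam * f v) z) ef.
    case: (eqVneq (u n z) 0) => [->|uz]; first by rewrite expr0n !mulr0.
    by rewrite (gE n)// -mulrA.
  have b : `|\sum_(z <- r) f z * u n z| <= (F + 1) / 2.
    have fr := hF r ur; rewrite ler_norml; apply/andP; split.
      rewrite -subr_ge0 opprK; apply: (@le_trans _ _ (\sum_(z <- r) (f z + u n z) ^+ 2 / 2)).
        by apply: sumr_ge0 => z _; rewrite divr_ge0// sqr_ge0.
      rewrite (eq_bigr (fun z => f z * u n z + (f z ^+ 2 / 2 + u n z ^+ 2 / 2))) => [|z _]; last by field.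
      by rewrite !big_split /= -!mulr_suml u1; lra.
    rewrite -subr_ge0; apply: (@le_trans _ _ (\sum_(z <- r) (f z - u n z) ^+ 2 / 2)).
      by apply: sumr_ge0 => z _; rewrite divr_ge0// sqr_ge0.
    rewrite (eq_bigr (fun z => (f z ^+ 2 / 2 + u n z ^+ 2 / 2) - f z * u n z)) => [|z _]; last by field.
    by rewrite sumrB !big_split /= -!mulr_suml u1; lra.
  have s0 : 0 < Num.sqrt (d n) by rewrite sqrtr_gt0.
  have : Num.sqrt (d n) <= d n * ((F + 1) / 2).
    by rewrite -[leLHS](ger0_norm (ltW s0)) -e normrM; exact: ler_wpM2l.
  have e2 : d n = Num.sqrt (d n) * Num.sqrt (d n) by rewrite -expr2 sqr_sqrtr// ltW.
  by rewrite [X in _ <= X * _]e2 -mulrA -[leLHS]mulr1 ler_pM2l//; lra.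
have F1 : 0 < (F + 1)^-1 ^+ 2 by rewrite exprn_gt0// invr_gt0; lra.
have [n hn] := radius_small p F1.
have := key n; rewrite leNgt => /negP; apply.
apply: (@le_lt_trans _ _ 1); last lra.
rewrite -ler_pdivlMr; last lra.
rewrite div1r -[leRHS]ger0_norm ?invr_ge0; last lra.
by rewrite -sqrtr_sqr ler_wsqrtr// (le_trans (dn n))// ltW.
Qed.

(** Off the levels the phi-orbit never meets [pole], so renormalization can continue until the
    iterate exceeds [M]; a nonregular [lam] must have a bounded orbit. *)
Lemma spectrum_orbit w : spectrum R p (sorbit w) = closure (levels p).
Proof.
rewrite closure_levels//; apply/seteqP; split=> lam; last first.
  by case=> [/julia_not_resolvent|[n /level_not_resolvent]]; exact.
move=> nres; case: (pselect (levels p lam)) => [|nl]; [by right|left].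
have [M hM] := @resolvent_large_ex R p.
apply: (@bounded_orbit_julia _ _ hp _ M) => n; rewrite leNgt; apply/negP => h.
apply: nres; apply: (resolvent_untrapped hM _ h) => k; apply/eqP => e.
by apply: nl; exists k; exact: iter_phi_mem_level.
Qed.

End Eigenfunctions.

(** * The spectral measure *)

Section TestFunctions.
Context {R : realType}.
Implicit Types (x y : R) (f : R -> R) (mu : {measure set R -> \bar R}).

(** Continuous functions decreasing to the indicator of [x], through which weak convergence can see
    an atom. *)
Definition tent x n y : R := Num.max 0 (1 - n%:R * `|y - x|).

Lemma tent_continuous x n : continuous (tent x n).
Proof.
pose h y := 1 - n%:R * `|y - x|.
have hc : continuous h.
  move=> y; apply: cvgB; first exact: cvg_cst.
  apply: cvgM; first exact: cvg_cst.
  by apply: cvg_norm; apply: cvgB; [exact: cvg_id|exact: cvg_cst].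
have -> : tent x n = (fun y => (h y + `|h y|) / 2).
  apply/funext => y; rewrite /tent -/(h y).
  by case: (leP 0 (h y)) => h0; [rewrite ger0_norm//|rewrite ltr0_norm//]; lra.
move=> y; apply: cvgM; last exact: cvg_cst.
by apply: cvgD; [exact: hc|apply: cvg_norm; exact: hc].
Qed.

Lemma tent_bound x n y : 0 <= tent x n y <= 1.
Proof.
rewrite /tent le_max lexx /= ge_max ler01 /=.
by rewrite gerBl mulr_ge0.
Qed.

Lemma tent_cvg x y : (fun n => tent x n y) @ \oo --> (\1_[set x] y : R).
Proof.
rewrite indicE; case: (eqVneq y x) => [->|yx].
  rewrite mem_set//; under eq_fun do rewrite /tent subrr normr0 mulr0 subr0.
  rewrite (_ : Num.max _ _ = 1); [exact: cvg_cst|by rewrite maxEle ler01].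
rewrite memNset; last by move=> e; rewrite e eqxx in yx.
have d0 : 0 < `|y - x| by rewrite normr_gt0 subr_eq0.
apply: cvg_near_cst; exists (Num.bound `|y - x|^-1) => // n /= hn.
apply/eqP; rewrite eq_le le_max lexx /= andbT ge_max lexx /= subr_le0.
rewrite -ler_pdivrMr// div1r; apply: le_trans (ltW (archi_boundP _)) _.
  by rewrite invr_ge0.
by rewrite ler_nat.
Qed.

Lemma measurable_cont f : continuous f -> measurable_fun [set: R] (EFin \o f).
Proof.
by move=> cf; apply/measurable_EFinP; exact: continuous_measurable_fun.
Qed.

Lemma tent_integral_cvg mu x : (mu setT < +oo)%E ->
  (fun n => \int[mu]_y (tent x n y)%:E)%E @ \oo --> mu [set x].
Proof.
move=> muf.
have -> : mu [set x] = (\int[mu]_y (\1_[set x] y)%:E)%E.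
  by rewrite integral_indic// setIT.
apply: (@dominated_cvg _ _ _ mu setT measurableT (fun n y => (tent x n y)%:E) _ (fun=> 1%E)) => //.
- by move=> n; apply: measurable_cont; exact: tent_continuous.
- by move=> y _; apply: cvg_EFin; [exact: nearW|exact: tent_cvg].
- by apply/integrableP; split=> //; rewrite abse1 integral_cst// mul1e.
- by move=> n y _; have /andP[? ?] := tent_bound x n y; rewrite /= lee_fin ger0_norm.
Qed.

End TestFunctions.

(** * The explicit limit measure and its atoms *)

Section KNS.
Context {R : realType} (p : nat).
Hypothesis hp : (2 <= p)%N.
Implicit Types (x y : R) (f : R -> R) (n k : nat).

(** Multiplicity [(p-1)(p+1)^(N-k-1)] of a point of level [k], divided by the [(p+1)^N] vertices. *)
Definition mass k : R := (p%:R - 1) / p.+1%:R ^+ k.+1.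

Definition level_sum f k : R := \sum_(x <- level p k) f x.

Definition partial_KNS f n : R := \sum_(k < n) mass k * level_sum f k.

(** Unweighted transfer operator of [phi]: its [n]-th iterate at [2p] is the sum of [f] over the
    leftover eigenvalues. *)
Definition transfer f : R -> R := fun x => f (psi p true x) + f (psi p false x).

Let ge2p : (2 : R) <= p%:R. Proof. by rewrite (ler_nat _ 2 p). Qed.

Let q0 : (0 : R) < p.+1%:R. Proof. by rewrite ltr0n. Qed.

Lemma mass_ge0 k : 0 <= mass k.
Proof. by rewrite divr_ge0 ?exprn_ge0//; have := ge2p; lra. Qed.

Lemma level_sumS f k : level_sum f k.+1 = level_sum (transfer f) k.
Proof. by rewrite /level_sum /= big_cat /= !big_map -big_split. Qed.

Lemma sum_eigsS f n : \sum_(x <- eigs p n.+1) f x =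
  (p%:R - 1) * p.+1%:R ^+ n * f (pole p) + \sum_(x <- eigs p n) transfer f x.
Proof.
rewrite /= !big_cat /= !big_map -big_split big_nseq iter_addr_0 -[_ *+ _]mulr_natl.
by rewrite natrM natrX -subn1 natrB// (leq_trans _ hp).
Qed.

Lemma mean_eigs f n : p.+1%:R ^- n * \sum_(x <- eigs p n) f x =
  partial_KNS f n + p.+1%:R ^- n * iter n transfer f (2 * p%:R).
Proof.
have qn0 m : p.+1%:R ^+ m != 0 :> R by rewrite expf_neq0// gt_eqF.
elim: n f => [|n IH] f.
  by rewrite /partial_KNS big_ord0 add0r /= big_seq1.
rewrite sum_eigsS mulrDr.
have -> : p.+1%:R ^- n.+1 * \sum_(x <- eigs p n) transfer f x =
    p.+1%:R^-1 * (p.+1%:R ^- n * \sum_(x <- eigs p n) transfer f x).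
  by rewrite mulrA exprS invfM.
rewrite IH iterSr mulrDr addrA; congr (_ + _); last by rewrite mulrA -invfM -exprS.
rewrite /partial_KNS big_ord_recl /= mulr_sumr; congr (_ + _).
  rewrite /level_sum big_seq1 /mass expr1 exprS; field.
  by rewrite qn0 andbT nat1r gt_eqF.
apply: eq_bigr => k _; rewrite level_sumS /mass mulrA [_ ^+ (bump _ _).+1]exprS; congr (_ * _).
rewrite /bump /= add1n invfM; ring.
Qed.

Lemma transfer_bound f M n x : (forall y, `|f y| <= M) -> `|iter n transfer f x| <= 2 ^+ n * M.
Proof.
move=> fM; elim: n x => [|n IH] x; first by rewrite expr0 mul1r.
rewrite iterS /transfer exprS -mulrA (le_trans (ler_normD _ _))//.
by have := IH (psi p true x); have := IH (psi p false x); lra.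
Qed.

Lemma remainder_cvg f M : (forall y, `|f y| <= M) ->
  (fun n => p.+1%:R ^- n * iter n transfer f (2 * p%:R)) @ \oo --> (0 : R).
Proof.
move=> fM; have g0 : geometric M (2 / p.+1%:R : R) @ \oo --> (0 : R).
  apply: cvg_geometric; rewrite ger0_norm ?divr_ge0// ltr_pdivrMr//.
  by rewrite mul1r ltr_nat.
apply: (squeeze_cvgr (f := fun n => - (M * (2 / p.+1%:R) ^+ n)) (h := fun n => M * (2 / p.+1%:R) ^+ n)) => //.
  apply: nearW => n; rewrite -ler_norml normrM ger0_norm ?invr_ge0 ?exprn_ge0//.
  rewrite expr_div_n mulrA [leLHS]mulrC ler_wpM2r ?invr_ge0 ?exprn_ge0// [leRHS]mulrC.
  exact: transfer_bound.
by rewrite -oppr0; apply: cvgN.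
Qed.

Lemma KNS_partial (mu : {measure set R -> \bar R}) f M : KNS_measure R p mu ->
  continuous f -> (forall y, `|f y| <= M) ->
  (fun n => (partial_KNS f n)%:E) @ \oo --> (\int[mu]_x (f x)%:E)%E.
Proof.
move=> kmu cf fM.
have h := kmu f cf (ex_intro _ M fM) _ (eig_list_eigs hp).
have r : (fun n => (p.+1%:R ^- n * iter n transfer f (2 * p%:R))%:E) @ \oo --> (0 : \bar R)%E.
  by apply: cvg_EFin; [exact: nearW|exact: remainder_cvg fM].
rewrite (_ : (fun n => (partial_KNS f n)%:E) = (fun n => (p.+1%:R ^- n * \sum_(x <- eigs p n) f x)%:E -
    (p.+1%:R ^- n * iter n transfer f (2 * p%:R))%:E)%E); last first.
  by apply/funext => n; rewrite mean_eigs -EFinB addrK.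
by rewrite -[X in _ --> X]sube0; apply: cvgeB => //; rewrite fin_num_adde_defl.
Qed.

(** Telescoping: [2^k mass k] is the difference of consecutive powers of [2/(p+1)]. *)
Lemma partial_KNS1 n : partial_KNS (fun=> 1) n = 1 - (2 / p.+1%:R) ^+ n.
Proof.
rewrite /partial_KNS; elim: n => [|n IH]; first by rewrite big_ord0 expr0 subrr.
rewrite big_ord_recr /= IH /level_sum big_const_seq count_predT size_level iter_addr_0.
rewrite natrX /mass !expr_div_n !exprS -natr1; field.
by rewrite nat1r expf_neq0 gt_eqF.
Qed.

Lemma partial_KNS1_cvg : partial_KNS (fun=> 1) @ \oo --> (1 : R).
Proof.
have -> : partial_KNS (fun=> 1) = (fun n => 1 - geometric 1 (2 / p.+1%:R) n).
  by apply/funext => n; rewrite partial_KNS1 /= mul1r.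
rewrite -[X in _ --> X]subr0; apply: cvgB; first exact: cvg_cst.
apply: cvg_geometric; rewrite ger0_norm ?divr_ge0// ltr_pdivrMr//.
by rewrite mul1r ltr_nat.
Qed.

Lemma KNS_total (mu : {measure set R -> \bar R}) : KNS_measure R p mu -> mu setT = 1%E.
Proof.
move=> kmu.
have h := @KNS_partial mu (fun=> 1) 1 kmu (@cst_continuous R R 1) (fun _ => _).
have e : (\int[mu]_x 1%:E = mu setT)%E by rewrite integral_cst// mul1e.
rewrite -e; apply: (cvg_unique _ (h _)) => //.
  by rewrite normr1.
by apply: cvg_EFin; [exact: nearW|exact: partial_KNS1_cvg].
Qed.

(** Both measures integrate every tent to the same limit of [partial_KNS], so atoms need only be
    computed for the explicit measure. *)
Lemma KNS_point (mu nu : {measure set R -> \bar R}) x :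
  KNS_measure R p mu -> KNS_measure R p nu -> mu [set x] = nu [set x].
Proof.
move=> kmu knu.
have muf : (mu setT < +oo)%E by rewrite KNS_total// ltry.
have nuf : (nu setT < +oo)%E by rewrite KNS_total// ltry.
have e n : (\int[mu]_y (tent x n y)%:E = \int[nu]_y (tent x n y)%:E)%E.
  have b y : `|tent x n y| <= 1 by have /andP[? ?] := tent_bound x n y; rewrite ger0_norm.
  have hm := KNS_partial kmu (@tent_continuous _ x n) b.
  have hn := KNS_partial knu (@tent_continuous _ x n) b.
  exact: (cvg_unique _ hm hn).
have hm := @tent_integral_cvg _ mu x muf; have hn := @tent_integral_cvg _ nu x nuf.
rewrite (eq_cvg _ _ e) in hm; exact: (cvg_unique _ hm hn).
Qed.

Definition massnng k : {nonneg R} := NngNum (mass_ge0 k).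

(** Indexing by position in the list fits [msum]; the default of [nth] is never reached as the list
    has [2^k] entries. *)
Definition level_measure k : {measure set R -> \bar R} :=
  mscale (massnng k) (msum (fun i => \d_(nth 0 (level p k) i)) (2 ^ k)).

Definition KNS : {measure set R -> \bar R} := mseries level_measure 0.

Lemma KNS_ge0_integral f : continuous f -> (forall y, 0 <= f y) ->
  (fun n => (partial_KNS f n)%:E) @ \oo --> (\int[KNS]_x (f x)%:E)%E.
Proof.
move=> cf f0; have mf := measurable_cont cf.
have f0' y : setT y -> (0 <= (f y)%:E)%E by rewrite lee_fin.
rewrite /KNS ge0_integral_measure_series//.
have E k : (\int[level_measure k]_x (f x)%:E = (mass k * level_sum f k)%:E)%E.
  rewrite /level_measure ge0_integral_mscale// ge0_integral_measure_sum//.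
  have -> : level_sum f k = \sum_(i < 2 ^ k) f (level p k)`_i.
    by rewrite /level_sum (big_nth 0) big_mkord size_level.
  rewrite [RHS]EFinM; congr (_ * _)%E; rewrite -sumEFin.
  by apply: eq_bigr => i _; rewrite integral_dirac// diracT mul1e.
rewrite (eq_eseriesr (g := fun k => (mass k * level_sum f k)%:E)); last by move=> k _; rewrite E.
have -> : (fun n => (partial_KNS f n)%:E) = (fun n => \sum_(0 <= k < n) (mass k * level_sum f k)%:E)%E.
  by apply/funext => n; rewrite sumEFin big_mkord.
apply: is_cvg_nneseries => k _ _; rewrite lee_fin mulr_ge0 ?mass_ge0// sumr_ge0//.
Qed.

Lemma KNS_finite : KNS setT = 1%E.
Proof.
have h := @KNS_ge0_integral (fun=> 1) (@cst_continuous R R 1) (fun _ => ler01).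
have e : (\int[KNS]_x 1%:E = KNS setT)%E by rewrite integral_cst// mul1e.
rewrite -e; apply: (cvg_unique _ h) => //.
by apply: cvg_EFin; [exact: nearW|exact: partial_KNS1_cvg].
Qed.

Lemma partial_KNSD f g n : partial_KNS (fun y => f y + g y) n = partial_KNS f n + partial_KNS g n.
Proof.
by rewrite /partial_KNS -big_split; apply: eq_bigr => k _; rewrite /level_sum big_split mulrDr.
Qed.

(** Reduction to nonnegative functions: [f] is [f + M] minus the constant [M], both integrable since
    the total mass is 1. *)
Lemma KNS_integral f M : continuous f -> (forall y, `|f y| <= M) ->
  (fun n => (partial_KNS f n)%:E) @ \oo --> (\int[KNS]_x (f x)%:E)%E.
Proof.
move=> cf fM.
have cM : continuous (fun=> M : R) := @cst_continuous R R M.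
have M0 : 0 <= M by apply: le_trans (normr_ge0 _) (fM 0).
have g0 y : 0 <= f y + M by have := fM y; rewrite ler_norml => /andP[]; lra.
have hM := KNS_ge0_integral cM (fun _ => M0).
have cg : continuous (fun y => f y + M).
  by move=> y; apply: cvgD; [exact: cf|exact: cM].
have hg := KNS_ge0_integral cg g0.
have intf : KNS.-integrable setT (fun y => (f y)%:E).
  apply: (@le_integrable _ _ _ _ _ measurableT _ (fun=> M%:E)).
  - exact: measurable_cont.
  - by move=> y _; rewrite /= lee_fin (ger0_norm M0).
  - apply/integrableP; split=> //; rewrite integral_cst// KNS_finite mule1.
    exact: ltry.
have intM : KNS.-integrable setT (fun=> M%:E).
  apply/integrableP; split=> //; rewrite integral_cst// KNS_finite mule1; exact: ltry.
have eM : (\int[KNS]_x M%:E = M%:E)%E by rewrite integral_cst// KNS_finite mule1.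
have eg : (\int[KNS]_x (f x + M)%:E = \int[KNS]_x (f x)%:E + M%:E)%E.
  rewrite -eM -integralD//.
rewrite (_ : (fun n => (partial_KNS f n)%:E) =
    (fun n => (partial_KNS (fun y => f y + M)%R n)%:E - (partial_KNS (fun=> M) n)%:E)%E); last first.
  by apply/funext => n; rewrite partial_KNSD -EFinB addrK.
rewrite (_ : (\int[KNS]_x (f x)%:E = \int[KNS]_x (f x + M)%:E - \int[KNS]_x M%:E)%E); last first.
  by rewrite eg eM addeK.
by apply: cvgeB; [rewrite eM fin_num_adde_defl|exact: hg|exact: hM].
Qed.

Lemma KNS_measure_KNS : KNS_measure R p KNS.
Proof.
move=> f cf [M fM] s hs.
have -> : (fun n => (p.+1%:R ^- n * \sum_(x <- s n) f x)%:E) =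
    (fun n => (partial_KNS f n)%:E + (p.+1%:R ^- n * iter n transfer f (2 * p%:R))%:E)%E.
  (* Any eigenvalue list is a permutation of [eigs], by unique factorization of the characteristic
     polynomial. *)
  apply/funext => n; rewrite -EFinD -mean_eigs; congr (_ * _)%:E; apply: perm_big.
  by apply: prod_XsubC_eq; rewrite -(hs n) -(eig_list_eigs hp n).
have r : (fun n => (p.+1%:R ^- n * iter n transfer f (2 * p%:R))%:E) @ \oo --> (0 : \bar R)%E.
  by apply: cvg_EFin; [exact: nearW|exact: remainder_cvg fM].
rewrite -[X in _ --> X]adde0; apply: cvgeD => //; last exact: KNS_integral fM.
by rewrite fin_num_adde_defl.
Qed.

(** The levels are disjoint and free of repetitions, so a single Dirac mass sits at [x]. *)
Lemma KNS_atom n x : x \in level p n -> KNS [set x] = (mass n)%:E.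
Proof.
move=> xn.
have E k : level_measure k [set x] = ((k == n)%:R * mass n)%:E.
  rewrite /level_measure /= /mscale /= /msum.
  have -> : (\sum_(i < 2 ^ k) \d_(nth 0%R (level p k) i) [set x] = ((x \in level p k)%:R)%:E :> \bar R)%E.
    rewrite -(@size_level R p k) -(big_mkord xpredT (fun i => \d_(nth 0%R (level p k) i) [set x])).
    rewrite -(big_nth 0%R xpredT (fun y => \d_y [set x])).
    rewrite (eq_bigr (fun y => ((y == x)%:R)%:E)) => [|y _]; last first.
      by rewrite diracE (_ : (y \in [set x]) = (y == x))//; apply/idP/eqP; rewrite inE.
    rewrite sumEFin -[RHS]/((_ : nat)%:R%:E); congr _%:E.
    rewrite -natr_sum -count_uniq_mem ?level_uniq// -sum1_count [in RHS]big_mkcond.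
    by congr _%:R; apply: eq_bigr => i _ /=; case: eqP.
  rewrite -EFinM; congr _%:E; case: eqP => [->|kn]; first by rewrite xn mulr1 mul1r.
  have -> : (x \in level p k) = false by apply/negP => /(level_disjoint hp xn) /esym.
  by rewrite mulr0 mul0r.
rewrite /KNS /mseries /=; apply/cvg_lim => //; apply: cvg_near_cst.
exists n.+1 => // N /= nN.
rewrite (eq_bigr (fun k => ((k == n)%:R * mass n)%:E)); last by move=> k _; exact: E.
rewrite (bigD1_seq n) ?mem_index_iota ?iota_uniq//= eqxx mul1r big1 ?adde0//.
by move=> k /negPf ->; rewrite mul0r.
Qed.

Lemma measure_seq (mu : {measure set R -> \bar R}) (l : seq R) : uniq l ->
  mu [set` l] = (\sum_(x <- l) mu [set x])%E.
Proof.
move=> ul; have -> : [set` l] = \bigcup_(x in [set` l]) [set x].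
  by apply/seteqP; split=> y; [move=> yl; exists y|move=> [x xl ->]].
rewrite measure_fin_bigcup.
- by rewrite -fsbig_seq.
- exact: finite_seq.
- by move=> x y _ _ [z [-> ->]].
- by move=> x _; exact: measurable_set1.
Qed.

(** The atoms on the levels already sum to 1, the total mass, so nothing is left for the
    complement. *)
Lemma KNS_supp (mu : {measure set R -> \bar R}) : KNS_measure R p mu ->
  mu (~` levels p) = 0%E.
Proof.
move=> kmu; have kK := KNS_measure_KNS.
have mlev k : measurable [set` level p k : seq R].
  by apply: countable_measurable; [move=> x; exact: measurable_set1|exact/finite_set_countable/finite_seq].
have S : levels p = \bigcup_k [set` level p k] :> set R.
  by apply/seteqP; split=> y; [move=> [k yk]; exists k|move=> [k _ yk]; exists k].
have mS : measurable (levels p : set R) by rewrite S; exact: bigcup_measurable.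
have muS : mu (levels p) = 1%E.
  rewrite S measure_bigcup//; last first.
    move=> m n _ _ [x [xm xn]]; exact: (level_disjoint hp xm xn).
  apply/cvg_lim => //.
  rewrite (_ : (fun n => _) = (fun n => (partial_KNS (fun=> 1) n)%:E)); last first.
    apply/funext => n; rewrite /partial_KNS -sumEFin -(big_mkord xpredT (fun k => (mass k * level_sum (fun=> 1) k)%:E)).
    apply: eq_big => k; first by rewrite in_setT.
    move=> _; rewrite measure_seq ?level_uniq// big_seq (eq_bigr (fun=> (mass k)%:E)) => [|x xk]; last first.
      by rewrite (KNS_point x kmu kK) (KNS_atom xk).
    by rewrite -big_seq sumEFin /level_sum mulr_sumr; congr _%:E; apply: eq_bigr => x _; rewrite mulr1.
  by apply: cvg_EFin; [exact: nearW|exact: partial_KNS1_cvg].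
have := KNS_total kmu.
rewrite -(setUv (levels p)) measureU//; [|exact: measurableC|by rewrite setICr].
move=> h; have {}h : (1 + mu (~` levels p) = 1)%E.
  exact: etrans (congr1 (fun a => a + _)%E (esym muS)) h.
rewrite -[LHS](@addeK _ 1%E)// [X in (X - _)%E]addeC [X in (X - _)%E]h.
by rewrite subee.
Qed.

End KNS.

Theorem theorem3p10 (R : realType) (p : nat) (hp : (2 <= p)%N) :
  (forall w : nat -> 'I_p.+1, infinite_set (sorbit w) ->
     spectrum R p (sorbit w) = closure (Sset R p)) /\
  (exists C : set R,
     cantor_set R C /\ (lebesgue_measure C = 0)%E /\
     (forall x, C x <-> C (2 * (p%:R - 1) - x)) /\
     closure (Sset R p) = C `|` Sset R p /\
     countable (Sset R p) /\
     (forall x, Sset R p x -> exists2 e : R, 0 < e &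
        forall y, closure (Sset R p) y -> `|y - x| < e -> y = x)) /\
  (exists mu : {measure set R -> \bar R}, KNS_measure R p mu) /\
  (forall mu : {measure set R -> \bar R}, KNS_measure R p mu ->
     (mu (~` Sset R p) = 0)%E /\
     (forall n, (1 <= n)%N -> forall x, Rset R p n x ->
        mu [set x] = ((p%:R - 1) / (p.+1%:R ^+ n.+1))%:E) /\
     mu [set 2 * (p%:R - 1)] = ((p%:R - 1) / p.+1%:R)%:E).
Proof.
split; first by move=> w _; rewrite SsetE//; exact: spectrum_orbit.
split.
  exists (julia p); rewrite SsetE//; do ! split.
  - by exists (2 * p%:R); exact: julia_right.
  - exact: julia_compact.
  - exact: julia_perfect.
  - exact: julia_no_interval.
  - exact: julia_null.
  - by rewrite -[julia p (_ - x)]/(julia p (pole p - x)) julia_sym.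
  - by rewrite -[julia p (_ - x)]/(julia p (pole p - x)) julia_sym.
  - exact: closure_levels.
  - exact: levels_countable.
  - exact: closure_levels_isolated.
split; first by exists (KNS hp); exact: KNS_measure_KNS.
move=> mu kmu; have kK := @KNS_measure_KNS R p hp.
split; first by rewrite SsetE//; exact: KNS_supp kmu.
split.
  by move=> n n1 x /(RsetE _ _ n1) xn; rewrite (KNS_point hp x kmu kK) (KNS_atom hp xn).
rewrite (KNS_point hp _ kmu kK) (KNS_atom hp (n := 0%N)) ?inE//.
Qed.
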